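(* For every $\epsilon,\delta>0$ there exist $N$ and a constant $c_\Delta$ (depending on $\epsilon,\delta,|\mathcal{X}|,|\mathcal{Y}|$) such that for every $n\ge N$ there is a rate-adaptive system with feedback and common randomness over $n$ channel uses such that, for every sequence of channels $W_1,\dots,W_n$ from $\mathcal{X}$ to $\mathcal{Y}$: (1) the probability of error is at most $\epsilon$; (2) with probability at least $1-\delta$ the rate satisfies $R\ge C(\overline W)-\Delta_C$, where $\overline W=\frac1n\sum_{i=1}^nW_i$ and $\Delta_C=c_\Delta\left(\frac{\ln^2 n}{n}\right)^{1/4}$.
   Context: $\mathcal{X},\mathcal{Y}$ are finite sets. A channel is a conditional pmf $W(y|x)$; $I(Q,W)$ is the mutual information in bits of the joint law $Q(x)W(y|x)$ and $C(W)=\max_Q I(Q,W)$. Channel model: $\Pr(\mathbf Y|\mathbf X)=\prod_{i=1}^n W_i(Y_i|X_i)$ (the output at time $i$ depends only on $X_i$ through $W_i$). A rate-adaptive system with feedback and common randomness over $n$ channel uses consists of: a random variable $S$ (common randomness) known to encoder and decoder, independent of the message and the channel; a message given by an infinite sequence of i.i.d. uniform bits $b_1,b_2,\dots$; encoding functions $X_i=f_i(b_1^\infty,Y_1^{i-1},S)$ (perfect instantaneous feedback); and a decoder that after $n$ uses outputs a rate $R=g(Y_1^n,S)\ge0$ and an estimate of the first $\lceil nR\rceil$ message bits; an error occurs if this estimate differs from $b_1^{\lceil nR\rceil}$. *)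

(* Defs.v *)
From Stdlib Require Import Reals ClassicalEpsilon.
From mathcomp Require Import all_boot.

Set Implicit Arguments.
Unset Strict Implicit.
Unset Printing Implicit Defensive.

Local Open Scope R_scope.

Notation "\rsum_ ( i : T ) F" := (\big[Rplus/R0]_(i : T) (F : R))
  (at level 41, F at level 41, i, T at level 50) : R_scope.
Notation "\rsum_ ( i < n ) F" := (\big[Rplus/R0]_(i < n) (F : R))
  (at level 41, F at level 41, i, n at level 50) : R_scope.
Notation "\rprod_ ( i < n ) F" := (\big[Rmult/R1]_(i < n) (F : R))
  (at level 36, F at level 36, i, n at level 50) : R_scope.

Definition log2 (r : R) : R := ln r / ln 2.

Definition is_pmf (T : finType) (P : T -> R) : Prop :=
  (forall t, 0 <= P t) /\ \rsum_(t : T) P t = 1.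

Definition is_channel (X Y : finType) (W : X -> Y -> R) : Prop :=
  forall x, is_pmf (W x).

Definition out_marg (X Y : finType) (Q : X -> R) (W : X -> Y -> R) (y : Y) : R :=
  \rsum_(x : X) (Q x * W x y).

(* Mutual information (in bits) of the joint law Q(x)W(y|x),
   with the convention 0 log 0 = 0. *)
Definition mutual_info (X Y : finType) (Q : X -> R) (W : X -> Y -> R) : R :=
  \rsum_(x : X) \rsum_(y : Y)
    (if Rlt_dec 0 (Q x * W x y)
     then Q x * W x y * log2 (W x y / out_marg Q W y)
     else 0).

Definition MI_values (X Y : finType) (W : X -> Y -> R) : R -> Prop :=
  fun r => exists Q : X -> R, is_pmf Q /\ r = mutual_info Q W.

(* Capacity C(W) = max_Q I(Q,W), defined as the least upper bound of the
   values I(Q,W) (the maximum is attained, so this is the max). *)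
Definition capacity (X Y : finType) (W : X -> Y -> R) : R :=
  epsilon (inhabits 0) (fun c => is_lub (MI_values W) c).

Definition avg_channel (X Y : finType) (n : nat) (W : 'I_n -> X -> Y -> R)
  : X -> Y -> R :=
  fun x y => / INR n * \rsum_(i < n) W i x y.

Definition ceilR (x : R) : nat := Z.to_nat (- Int_part (- x))%Z.

(* A rate-adaptive system with feedback and common randomness over n uses.
   - cr      : (finite) set of values of the common randomness S,
   - cr_pmf  : its distribution,
   - nbits   : the encoder reads the first nbits message bits b_1..b_nbits,
   - enc i b past s : X_i = f_i(b, Y_1^{i-1}, s), where past = Y_1^{i-1}
                      (i indexed from 0),
   - rate y s : R = g(Y_1^n, S) (required >= 0),
   - est y s  : the estimate of the first ceil(nR) message bits.            *)
Record ra_system (X Y : finType) (n : nat) : Type := RASystem {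
  cr : finType;
  cr_pmf : cr -> R;
  nbits : nat;
  enc : 'I_n -> nbits.-tuple bool -> seq Y -> cr -> X;
  rate : n.-tuple Y -> cr -> R;
  est : n.-tuple Y -> cr -> seq bool
}.
Arguments cr {X Y n} _.
Arguments cr_pmf {X Y n} _ _.
Arguments nbits {X Y n} _.
Arguments enc {X Y n} _ _ _ _ _.
Arguments rate {X Y n} _ _ _.
Arguments est {X Y n} _ _ _.

Definition valid_system (X Y : finType) (n : nat) (sys : ra_system X Y n) : Prop :=
  is_pmf (cr_pmf sys) /\ (forall y s, 0 <= rate sys y s).

Definition joint_prob (X Y : finType) (n : nat) (sys : ra_system X Y n)
  (W : 'I_n -> X -> Y -> R) (s : cr sys) (b : (nbits sys).-tuple bool)
  (y : n.-tuple Y) : R :=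
  cr_pmf sys s * / 2 ^ (nbits sys) *
  \rprod_(i < n) W i (enc sys i b (take i y) s) (tnth y i).

Arguments joint_prob {X Y n} sys W s b y.

Definition sys_prob (X Y : finType) (n : nat) (sys : ra_system X Y n)
  (W : 'I_n -> X -> Y -> R)
  (E : cr sys -> (nbits sys).-tuple bool -> n.-tuple Y -> bool) : R :=
  \rsum_(s : cr sys) \rsum_(b : (nbits sys).-tuple bool)
    \rsum_(y : n.-tuple Y) (if E s b y then joint_prob sys W s b y else 0).

Arguments sys_prob {X Y n} sys W E.

(* Error event: the estimate differs from b_1^{ceil(nR)}.  If ceil(nR)
   exceeds the number of bits read by the encoder we (conservatively)
   count it as an error. *)
Definition error_event (X Y : finType) (n : nat) (sys : ra_system X Y n)
  (s : cr sys) (b : (nbits sys).-tuple bool) (y : n.-tuple Y) : bool :=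
  let m := ceilR (INR n * rate sys y s) in
  (nbits sys < m)%N || (est sys y s != take m b).

Arguments error_event {X Y n} sys s b y.

Definition error_prob (X Y : finType) (n : nat) (sys : ra_system X Y n)
  (W : 'I_n -> X -> Y -> R) : R :=
  sys_prob sys W (error_event sys).

Arguments error_prob {X Y n} sys W.

Definition rate_at_least_prob (X Y : finType) (n : nat) (sys : ra_system X Y n)
  (W : 'I_n -> X -> Y -> R) (r0 : R) : R :=
  sys_prob sys W (fun s b y => if Rle_dec r0 (rate sys y s) then true else false).

Arguments rate_at_least_prob {X Y n} sys W r0.
Arguments valid_system {X Y n} sys.

Definition delta_C (c : R) (n : nat) : R :=
  c * sqrt (sqrt (ln (INR n) ^ 2 / INR n)).

(* Main.v *)
(** Each pair (input law Q, backward channel V) assigns the letter pair (x, y)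
    the score ln (V(x|y) / Q(x)); its mean under Q and a channel W is concave
    in (Q, V), linear in W, and its maximum over (Q, V) is C(W).  Every
    candidate message runs its own online learner (exponential weights on the
    linearised score, mixed with the uniform law) on the letter pairs which it
    would have produced: its next codeword letter is drawn from the current Q.
    For the candidate sent, the total score is then n C(avg W) up to lower-order
    terms, because the linearised score dominates the score of any comparator
    in the mean and the learner has small regret.  For any other candidate the
    exponential of the score is a martingale, whatever the channels are.  So the
    bits are sent in blocks of K, a block being decoded as soon as the score of
    some candidate exceeds K ln 2 plus a logarithmic margin: the number of
    blocks decoded within n uses is about the total score divided by K ln 2. *)
From HB Require Import structures.
Require Import Defs.
From Stdlib Require Import Reals Lra Lia ZArith ClassicalEpsilon.
From mathcomp Require Import all_boot.

Set Implicit Arguments.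
Unset Strict Implicit.
Unset Printing Implicit Defensive.

Local Open Scope R_scope.

(** * Finite real sums and probability mass functions *)

Lemma RplusA : associative Rplus. Proof. by move=> x y z; ring. Qed.
Lemma RmultA : associative Rmult. Proof. by move=> x y z; ring. Qed.
Lemma RmultDl : left_distributive Rmult Rplus. Proof. by move=> x y z; ring. Qed.
Lemma RmultDr : right_distributive Rmult Rplus. Proof. by move=> x y z; ring. Qed.

HB.instance Definition _ := Monoid.isComLaw.Build R R0 Rplus RplusA Rplus_comm Rplus_0_l.
HB.instance Definition _ := Monoid.isComLaw.Build R R1 Rmult RmultA Rmult_comm Rmult_1_l.
HB.instance Definition _ := Monoid.isMulLaw.Build R R0 Rmult Rmult_0_l Rmult_0_r.
HB.instance Definition _ := Monoid.isAddLaw.Build R Rmult Rplus RmultDl RmultDr.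

Section RealSums.
Variables (I : Type) (r : seq I) (P : pred I).

Lemma rsum_le (F G : I -> R) :
  (forall i, P i -> F i <= G i) ->
  \big[Rplus/R0]_(i <- r | P i) F i <= \big[Rplus/R0]_(i <- r | P i) G i.
Proof. by move=> FG; elim/big_ind2: _ => // *; lra. Qed.

Lemma rsum_ge0 (F : I -> R) :
  (forall i, P i -> 0 <= F i) -> 0 <= \big[Rplus/R0]_(i <- r | P i) F i.
Proof. by move=> F0; elim/big_ind: _ => // *; lra. Qed.

Lemma rprod_ge0 (F : I -> R) :
  (forall i, P i -> 0 <= F i) -> 0 <= \big[Rmult/R1]_(i <- r | P i) F i.
Proof. by move=> F0; elim/big_ind: _ => // *; [lra | apply: Rmult_le_pos]. Qed.

Lemma rsumMl c (F : I -> R) :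
  \big[Rplus/R0]_(i <- r | P i) (c * F i) = c * \big[Rplus/R0]_(i <- r | P i) F i.
Proof. by rewrite big_distrr. Qed.

Lemma rsumMr c (F : I -> R) :
  \big[Rplus/R0]_(i <- r | P i) (F i * c) = \big[Rplus/R0]_(i <- r | P i) F i * c.
Proof. by rewrite big_distrl. Qed.

Lemma rsumD (F G : I -> R) :
  \big[Rplus/R0]_(i <- r | P i) (F i + G i) =
  \big[Rplus/R0]_(i <- r | P i) F i + \big[Rplus/R0]_(i <- r | P i) G i.
Proof. exact: big_split. Qed.

End RealSums.

Lemma rsum_term_le (I : finType) (P : pred I) (F : I -> R) j :
  P j -> (forall i, P i -> 0 <= F i) -> F j <= \big[Rplus/R0]_(i | P i) F i.
Proof.
move=> Pj F0; rewrite (bigD1 j) //=.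
suff: 0 <= \big[Rplus/R0]_(i | P i && (i != j)) F i by lra.
by apply: rsum_ge0 => i /andP[/F0].
Qed.

Lemma rsum_const (I : finType) (P : pred I) c :
  \big[Rplus/R0]_(i | P i) c = INR #|P| * c.
Proof.
rewrite big_const; elim: #|P| => [|k IH]; first by rewrite /=; lra.
by rewrite iterS IH S_INR; lra.
Qed.

Lemma rsum_cst (I : finType) c : \rsum_(i : I) c = INR #|I| * c.
Proof. by rewrite rsum_const. Qed.

Lemma rsum_only (I : finType) (F : I -> R) j :
  (forall i, i != j -> F i = 0) -> \rsum_(i : I) F i = F j.
Proof.
move=> F0; rewrite (bigD1 j) //= big1 ?Rplus_0_r //.
Qed.

Section Pmf.
Variables (T : finType) (p : T -> R) (pp : is_pmf p).

Lemma pmf_ge0 t : 0 <= p t. Proof. by case: pp. Qed.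

Lemma pmf_sum : \rsum_(t : T) p t = 1. Proof. by case: pp. Qed.

Lemma pmf_le1 t : p t <= 1.
Proof. by rewrite -pmf_sum; apply: rsum_term_le => // i _; apply: pmf_ge0. Qed.

Lemma pmf_mean_le (F : T -> R) c :
  (forall t, F t <= c) -> \rsum_(t : T) (p t * F t) <= c.
Proof.
move=> Fc; apply: (@Rle_trans _ (\rsum_(t : T) (p t * c))).
  by apply: rsum_le => t _; apply: Rmult_le_compat_l; [apply: pmf_ge0|].
by rewrite rsumMr pmf_sum; lra.
Qed.

Lemma pmf_mean_cst c : \rsum_(t : T) (p t * c) = c.
Proof. by rewrite rsumMr pmf_sum; lra. Qed.

End Pmf.

(** * Elementary bounds on logarithm and exponential *)

Lemma ln_le_sub1 t : 0 < t -> ln t <= t - 1.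
Proof. by move=> t0; have := exp_ineq1_le (ln t); rewrite exp_ln //; lra. Qed.

(** Multiply both sides by [1 - t]: the left becomes at most [1], the right equals
    [1 + t^2 * (1 - 2 * t)]. *)
Lemma exp_le_quadratic t : t <= / 2 -> exp t <= 1 + t + 2 * t ^ 2.
Proof.
move=> t2.
have e1 := exp_ineq1_le (- t); have e0 := exp_pos t.
have ee : exp t * exp (- t) = 1 by rewrite -exp_plus Rplus_opp_r exp_0.
have : exp t * (1 - t) <= 1 by rewrite -ee; apply: Rmult_le_compat_l; lra.
have : 1 <= (1 + t + 2 * t ^ 2) * (1 - t) by nra.
nra.
Qed.

Lemma ln_le_mono a b : 0 < a -> a <= b -> ln a <= ln b.
Proof. by move=> a0 [ab | ->]; [left; apply: ln_increasing | lra]. Qed.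

(** * The online learner *)

Section ExponentialWeights.
Variables (X : finType) (eta : R).
Hypothesis X_gt0 : (0 < #|X|)%N.

Definition bump_at (G : X -> R) x0 g : X -> R :=
  fun x => G x + (if x == x0 then g else 0).

Definition partition_fun (G : X -> R) : R := \rsum_(x : X) exp (eta * G x).

Definition softmax (G : X -> R) : X -> R :=
  fun x => exp (eta * G x) / partition_fun G.

Lemma partition_fun_gt0 G : 0 < partition_fun G.
Proof.
have /card_gt0P[x _] := X_gt0.
apply: (Rlt_le_trans _ (exp (eta * G x))); first exact: exp_pos.
by apply: (@rsum_term_le _ xpredT (fun x => exp (eta * G x))) => // i _; left; apply: exp_pos.
Qed.

Lemma softmax_gt0 G x : 0 < softmax G x.
Proof. by apply: Rdiv_lt_0_compat; [apply: exp_pos | apply: partition_fun_gt0]. Qed.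

Lemma softmax_pmf G : is_pmf (softmax G).
Proof.
split=> [x|]; first by left; apply: softmax_gt0.
rewrite /softmax /Rdiv rsumMr -/(partition_fun G) Rinv_r //.
by apply: Rgt_not_eq; apply: partition_fun_gt0.
Qed.

(** Moving one gain multiplies the partition function by [1 + p * (exp t - 1)], with [p] the softmax
    weight. The first-order part is the learner's own gain, the quadratic part the price of a
    step. *)
Lemma ln_partition_fun_bump G x0 g : eta * g <= / 2 ->
  ln (partition_fun (bump_at G x0 g)) <=
  ln (partition_fun G) + softmax G x0 * (eta * g + 2 * (eta * g) ^ 2).
Proof.
move=> g2; have S0 := partition_fun_gt0 G; have p0 := softmax_gt0 G x0.
set p := softmax G x0 in p0 *; set t := eta * g in g2 *.
have E : partition_fun (bump_at G x0 g) = partition_fun G * (1 + p * (exp t - 1)).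
  rewrite /partition_fun (bigD1 x0) //= /bump_at eqxx.
  rewrite (eq_bigr (fun x => exp (eta * G x))) => [|x /negPf ->]; last first.
    by rewrite Rplus_0_r.
  have pS : p * partition_fun G = exp (eta * G x0).
    by rewrite /p /softmax; field; lra.
  have -> : partition_fun G * (1 + p * (exp t - 1)) =
            partition_fun G + p * partition_fun G * (exp t - 1) by ring.
  rewrite pS /partition_fun [in RHS](bigD1 x0) //= Rmult_plus_distr_l exp_plus -/t.
  by ring.
have [q0 q1] : 0 < p /\ p <= 1 by split=> //; apply: (pmf_le1 (softmax_pmf G)).
have et := exp_pos t.
have u0 : 0 < 1 + p * (exp t - 1) by nra.
rewrite E ln_mult //; apply: Rplus_le_compat_l.
apply: Rle_trans (ln_le_sub1 u0) _.
have := exp_le_quadratic g2; nra.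
Qed.

Lemma mean_le_ln_partition_fun (q : X -> R) G : is_pmf q ->
  eta * (\rsum_(x : X) (q x * G x)) <= ln (partition_fun G).
Proof.
move=> qp; rewrite -rsumMl (eq_bigr (fun x => q x * (eta * G x))); last first.
  by move=> x _; ring.
apply: pmf_mean_le => // x; rewrite -[X in X <= _]ln_exp; apply: ln_le_mono.
  exact: exp_pos.
by apply: (@rsum_term_le _ xpredT (fun x => exp (eta * G x))) => // i _; left; apply: exp_pos.
Qed.

Lemma ln_partition_fun0 : ln (partition_fun (fun=> 0)) = ln (INR #|X|).
Proof. by rewrite /partition_fun Rmult_0_r exp_0 rsum_cst Rmult_1_r. Qed.

Lemma mean_bump (q : X -> R) G x0 g :
  \rsum_(x : X) (q x * bump_at G x0 g x) = \rsum_(x : X) (q x * G x) + q x0 * g.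
Proof.
rewrite (eq_bigr (fun x => q x * G x + (if x == x0 then q x0 * g else 0))); last first.
  by move=> x _; rewrite /bump_at; case: eqP => [->|_]; ring.
rewrite rsumD; congr (_ + _); rewrite (@rsum_only _ _ x0) ?eqxx //.
by move=> i /negPf ->.
Qed.

End ExponentialWeights.

(* Histories list the most recent letter pair first. *)
Fixpoint hist_sum (X Y : Type) (g : seq (X * Y) -> X -> Y -> R) (h : seq (X * Y)) : R :=
  if h is xy :: h' then hist_sum g h' + g h' xy.1 xy.2 else 0.

Definition joint_mean (X Y : finType) (p : X -> R) (W : X -> Y -> R) (f : X -> Y -> R) : R :=
  \rsum_(x : X) (p x * \rsum_(y : Y) (W x y * f x y)).

(** * The learner for the input law and the backward channel *)

Section Learner.
Variables (X Y : finType) (lam eta : R).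
Hypothesis X_gt0 : (0 < #|X|)%N.
Hypothesis lam_gt0 : 0 < lam.
Hypothesis lam_le : lam <= / 2.
Hypothesis eta_gt0 : 0 < eta.

Let N := INR #|X|.

Lemma cardX_ge1 : 1 <= N.
Proof. by apply: (le_INR 1); apply/leP. Qed.

(** The uniform part keeps every probability above [lam / N], which bounds both the scores and the
    importance weights. *)
Definition smooth (q : X -> R) : X -> R := fun x => (1 - lam) * q x + lam / N.

Lemma lamN_gt0 : 0 < lam / N.
Proof. by have N1 := cardX_ge1; apply: Rdiv_lt_0_compat; lra. Qed.

Lemma smooth_ge q x : is_pmf q -> lam / N <= smooth q x.
Proof. by move=> /pmf_ge0/(_ x) q0; rewrite /smooth; nra. Qed.

Lemma smooth_pmf q : is_pmf q -> is_pmf (smooth q).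
Proof.
move=> qp; split=> [x|].
  by have := smooth_ge x qp; have := lamN_gt0; lra.
rewrite /smooth rsumD rsumMl pmf_sum // rsum_cst -/N.
by have N1 := cardX_ge1; field; lra.
Qed.

Lemma smooth_ge_half q x : is_pmf q -> q x <= 2 * smooth q x.
Proof.
by move=> /pmf_ge0/(_ x) q0; have := lamN_gt0; rewrite /smooth; nra.
Qed.

(** One gain vector for the input law and one for each output letter: [#|Y|.+1] exponential-weights
    learners side by side. *)
Record learner := Learner { gainQ : X -> R; gainV : Y -> X -> R }.

Definition inputQ (l : learner) : X -> R := smooth (softmax eta (gainQ l)).

Definition backV (l : learner) (y : Y) : X -> R := smooth (softmax eta (gainV l y)).

Definition llr (l : learner) x y : R := ln (backV l y x / inputQ l x).

(** The partial derivatives of [Q * ln (V / Q)] in [Q] and in [V] are [ln (V / Q) - 1] and [Q / V].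
    Dividing each by the probability [Q] of drawing the letter makes the observed slopes
    unbiased. *)
Definition slopeQ l x y : R := (llr l x y - 1) / inputQ l x.

Definition slopeV l x y : R := / backV l y x.

Definition update (l : learner) x y : learner :=
  Learner (bump_at (gainQ l) x (slopeQ l x y))
    (fun y' => if y' == y then bump_at (gainV l y) x (slopeV l x y) else gainV l y').

Fixpoint learn (h : seq (X * Y)) : learner :=
  if h is xy :: h' then update (learn h') xy.1 xy.2
  else Learner (fun=> 0) (fun _ _ => 0).

Lemma inputQ_pmf l : is_pmf (inputQ l).
Proof. by apply: smooth_pmf; apply: softmax_pmf. Qed.

Lemma backV_pmf l y : is_pmf (backV l y).
Proof. by apply: smooth_pmf; apply: softmax_pmf. Qed.

Lemma inputQ_ge l x : lam / N <= inputQ l x.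
Proof. by apply: smooth_ge; apply: softmax_pmf. Qed.

Lemma backV_ge l y x : lam / N <= backV l y x.
Proof. by apply: smooth_ge; apply: softmax_pmf. Qed.

Lemma inputQ_gt0 l x : 0 < inputQ l x.
Proof. by have := inputQ_ge l x; have := lamN_gt0; lra. Qed.

Lemma backV_gt0 l y x : 0 < backV l y x.
Proof. by have := backV_ge l y x; have := lamN_gt0; lra. Qed.

Definition llr_bound : R := ln (N / lam).

Lemma abs_ln_ratio_le p q : lam / N <= p <= 1 -> lam / N <= q <= 1 ->
  - llr_bound <= ln (p / q) <= llr_bound.
Proof.
move=> [p1 p2] [q1 q2]; have l0 := lamN_gt0; have N1 := cardX_ge1.
have E : llr_bound = - ln (lam / N).
  by rewrite /llr_bound /Rdiv !ln_mult ?ln_Rinv; try lra; apply: Rinv_0_lt_compat; lra.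
have hp := ln_le_mono l0 p1; have hq := ln_le_mono l0 q1.
have p0 : ln p <= 0 by rewrite -ln_1; apply: ln_le_mono; lra.
have q0 : ln q <= 0 by rewrite -ln_1; apply: ln_le_mono; lra.
rewrite /Rdiv ln_mult ?ln_Rinv; try lra.
by apply: Rinv_0_lt_compat; lra.
Qed.

Lemma llr_bounded l x y : - llr_bound <= llr l x y <= llr_bound.
Proof.
apply: abs_ln_ratio_le; split.
- exact: backV_ge.
- exact: (pmf_le1 (backV_pmf l y)).
- exact: inputQ_ge.
- exact: (pmf_le1 (inputQ_pmf l)).
Qed.

Lemma llr_bound_ge0 : 0 <= llr_bound.
Proof.
have N1 := cardX_ge1; rewrite /llr_bound -ln_1; apply: ln_le_mono; first lra.
by apply: (Rmult_le_reg_r lam) => //; rewrite /Rdiv Rmult_assoc Rinv_l; lra.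
Qed.

(** Each summand is [V], so the sum is the mass of the backward law. Hence a letter drawn
    independently of the output multiplies the exponential score by a factor of mean 1, whatever the
    output. *)
Lemma exp_llr_mean l y : \rsum_(x : X) (inputQ l x * exp (llr l x y)) = 1.
Proof.
rewrite -(pmf_sum (backV_pmf l y)); apply: eq_bigr => x _.
have Q0 := inputQ_gt0 l x; have V0 := backV_gt0 l y x.
by rewrite /llr exp_ln; [field; lra | apply: Rdiv_lt_0_compat].
Qed.

(** * Regret against a fixed comparator *)

Section Comparator.
Variables (q : X -> R) (v : Y -> X -> R).
Hypothesis q_pmf : is_pmf q.
Hypothesis v_pmf : forall y, is_pmf (v y).
Hypothesis step_small : eta * (N / lam * (llr_bound + 1)) <= / 2.

(* The first-order expansion of [Q x * ln (V y x / Q x)] around the played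
   pair, evaluated at the smoothed comparator and importance weighted: its
   average over the played pair is the played log-likelihood ratio. *)
Definition lin_llr (h : seq (X * Y)) x y : R :=
  smooth q x / inputQ (learn h) x * (llr (learn h) x y - 1) +
  smooth (v y) x / backV (learn h) y x.

Definition potential (l : learner) : R :=
  ln (partition_fun eta (gainQ l)) + \rsum_(y : Y) ln (partition_fun eta (gainV l y)).

Definition comparator_gain (l : learner) : R :=
  \rsum_(x : X) (q x * gainQ l x) + \rsum_(y : Y) \rsum_(x : X) (v y x * gainV l y x).

Definition second_order : R := 4 * (N / lam) * ((llr_bound + 1) ^ 2 + 1).

Lemma ratio_le_inv (p a : R) : lam / N <= p -> 0 <= a <= 1 -> a / p <= N / lam.
Proof.
move=> p1 [a0 a1]; have l0 := lamN_gt0; have N1 := cardX_ge1.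
have -> : N / lam = / (lam / N) by field; lra.
have i : / p <= / (lam / N) by apply: Rinv_le_contravar.
have j : 0 < / p by apply: Rinv_0_lt_compat; lra.
by rewrite /Rdiv; nra.
Qed.

Lemma slopeQ_small l x y : eta * slopeQ l x y <= / 2.
Proof.
apply: Rle_trans step_small; apply: Rmult_le_compat_l; first lra.
have [_ a1] := llr_bounded l x y; have B0 := llr_bound_ge0.
have i := @ratio_le_inv _ 1 (inputQ_ge l x) (conj Rle_0_1 (Rle_refl 1)).
have j : 0 < 1 / inputQ l x.
  by rewrite /Rdiv Rmult_1_l; apply: Rinv_0_lt_compat; apply: inputQ_gt0.
have -> : slopeQ l x y = 1 / inputQ l x * (llr l x y - 1).
  by rewrite /slopeQ; field; apply: Rgt_not_eq; apply: inputQ_gt0.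
by apply: Rle_trans (_ : 1 / inputQ l x * (llr_bound + 1) <= _); nra.
Qed.

Lemma slopeV_small l x y : eta * slopeV l x y <= / 2.
Proof.
apply: Rle_trans step_small; apply: Rmult_le_compat_l; first lra.
have B0 := llr_bound_ge0.
have := @ratio_le_inv _ 1 (backV_ge l y x) (conj Rle_0_1 (Rle_refl 1)).
have j : 0 < / backV l y x by apply: Rinv_0_lt_compat; apply: backV_gt0.
by rewrite /slopeV; nra.
Qed.

(** The smoothed probability dominates both half the softmax weight and [lam / N]: one factor
    [1 / s] cancels the weight, and only the other costs [N / lam]. *)
Lemma second_order_term p s (G : X -> R) x : s = smooth (softmax eta G) x ->
  softmax eta G x * (p / s) ^ 2 <= 2 * (N / lam) * p ^ 2.
Proof.
move=> ->; have sp := softmax_pmf eta X_gt0 G.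
have h1 := smooth_ge_half x sp.
have i := ratio_le_inv (smooth_ge x sp) (conj Rle_0_1 (Rle_refl 1)).
have s0 : 0 < smooth (softmax eta G) x by have := smooth_ge x sp; have := lamN_gt0; lra.
set s' := smooth _ _ in h1 i s0 *; set w := softmax _ _ _ in h1 *.
have w2 : w * (1 / s') <= 2.
  by apply: (Rmult_le_reg_r s') => //; rewrite /Rdiv Rmult_1_l Rmult_assoc Rinv_l; lra.
have j : 0 < 1 / s' by rewrite /Rdiv Rmult_1_l; apply: Rinv_0_lt_compat.
have -> : w * (p / s') ^ 2 = (w * (1 / s')) * (1 / s') * p ^ 2 by field; lra.
apply: Rmult_le_compat_r; first by apply: pow2_ge_0.
by apply: Rle_trans (_ : 2 * (1 / s') <= _); [apply: Rmult_le_compat_r; lra | lra].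
Qed.

Definition own_gain h x y : R :=
  softmax eta (gainQ (learn h)) x * slopeQ (learn h) x y +
  softmax eta (gainV (learn h) y) x * slopeV (learn h) x y.

(** A pair [(x, y)] moves only the input learner and the learner attached to [y], so two partition
    functions change. *)
Lemma potential_update l x y :
  potential (update l x y) <= potential l +
    eta * (softmax eta (gainQ l) x * slopeQ l x y +
           softmax eta (gainV l y) x * slopeV l x y) + eta ^ 2 * second_order.
Proof.
rewrite /potential (bigD1 y) //= eqxx [in X in _ <= X](bigD1 y) //=.
rewrite (eq_bigr (fun y' => ln (partition_fun eta (gainV l y')))); last first.
  by move=> y' /negPf ->.
set rest := \big[_/_]_(_ | _) _.
have hQ := ln_partition_fun_bump X_gt0 (gainQ l) x (slopeQ_small l x y).
have hV := ln_partition_fun_bump X_gt0 (gainV l y) x (slopeV_small l x y).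
have zQ : softmax eta (gainQ l) x * slopeQ l x y ^ 2 <=
    2 * (N / lam) * (llr l x y - 1) ^ 2 by apply: second_order_term.
have zV : softmax eta (gainV l y) x * slopeV l x y ^ 2 <= 2 * (N / lam) * 1 ^ 2.
  by rewrite -[slopeV l x y]Rmult_1_l; apply: second_order_term.
have a2 : (llr l x y - 1) ^ 2 <= (llr_bound + 1) ^ 2.
  have := llr_bounded l x y; set a := llr l x y => ?; nra.
have K0 : 0 < N / lam by have := cardX_ge1 => ?; apply: Rdiv_lt_0_compat; lra.
have e2 : 0 <= eta ^ 2 by apply: pow2_ge_0.
have z : 2 * (softmax eta (gainQ l) x * slopeQ l x y ^ 2 +
              softmax eta (gainV l y) x * slopeV l x y ^ 2) <= second_order.
  by rewrite /second_order; nra.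
have := Rmult_le_compat_l _ _ _ e2 z.
move: hQ hV; set A := softmax _ _ _; set A' := softmax _ _ _.
set s := slopeQ _ _ _; set s' := slopeV _ _ _; nra.
Qed.

Lemma potential_learn h :
  potential (learn h) <=
    INR #|Y|.+1 * ln N + eta * hist_sum own_gain h + INR (size h) * (eta ^ 2 * second_order).
Proof.
elim: h => [|[x y] h IH].
  rewrite /potential !ln_partition_fun0 rsum_cst -/N S_INR /=; lra.
have := potential_update (learn h) x y.
rewrite -/(own_gain h x y) -[update _ _ _]/(learn ((x, y) :: h)).
have -> : hist_sum own_gain ((x, y) :: h) = hist_sum own_gain h + own_gain h x y by [].
by have -> : INR (size ((x, y) :: h)) = INR (size h) + 1; [exact: S_INR | lra].
Qed.

Lemma comparator_gain_learn h :
  comparator_gain (learn h) =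
    hist_sum (fun h x y => q x * slopeQ (learn h) x y + v y x * slopeV (learn h) x y) h.
Proof.
elim: h => [|[x y] h IH].
  rewrite /comparator_gain /= big1 => [|x _]; last by ring.
  by rewrite big1 => [|y _]; [ring | rewrite big1 // => x _; ring].
rewrite [hist_sum _ _]/= -IH /comparator_gain [learn _]/= mean_bump.
rewrite (bigD1 y) //= eqxx mean_bump [in RHS](bigD1 y) //=.
rewrite (eq_bigr (fun y' => \rsum_(x : X) (v y' x * gainV (learn h) y' x))); first by ring.
by move=> y' /negPf ->.
Qed.

Lemma comparator_gain_le l : eta * comparator_gain l <= potential l.
Proof.
rewrite /comparator_gain Rmult_plus_distr_l; apply: Rplus_le_compat.
  exact: mean_le_ln_partition_fun.
by rewrite -rsumMl; apply: rsum_le => y _; apply: mean_le_ln_partition_fun.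
Qed.

Definition regret (n : nat) : R :=
  INR #|Y|.+1 * ln N / eta + INR n * (eta * second_order).

(** The potential is at least [eta] times the comparator's gain and grows by at most [eta] times the
    learner's own gain plus a second-order term; dividing by [eta] gives the regret. *)
Lemma lin_llr_sum_le h :
  hist_sum lin_llr h <= hist_sum (fun h => llr (learn h)) h + regret (size h).
Proof.
have reg : hist_sum (fun h x y => q x * slopeQ (learn h) x y + v y x * slopeV (learn h) x y) h
    - hist_sum own_gain h <= regret (size h).
  have := comparator_gain_le (learn h); have := potential_learn h.
  rewrite comparator_gain_learn => h1 h2.
  apply: (Rmult_le_reg_l eta) => //; rewrite /regret Rmult_plus_distr_l.
  have -> : eta * (INR #|Y|.+1 * ln N / eta) = INR #|Y|.+1 * ln N by field; lra.
  nra.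
(* The gap below carries a factor [1 - lam]; nonnegativity of the regret allows it to be dropped. *)
have reg0 : 0 <= regret (size h).
  apply: Rplus_le_le_0_compat.
    apply: Rmult_le_pos; last by left; apply: Rinv_0_lt_compat.
    apply: Rmult_le_pos; first exact: pos_INR.
    by rewrite -ln_1; apply: ln_le_mono; [lra | exact: cardX_ge1].
  apply: Rmult_le_pos; first exact: pos_INR.
  apply: Rmult_le_pos; first lra.
  have K0 : 0 < N / lam by have := cardX_ge1 => ?; apply: Rdiv_lt_0_compat; lra.
  by rewrite /second_order; have := llr_bound_ge0; nra.
(* At the played pair the linearisation returns [llr] itself. Comparator and learner share the
   uniform part, so their difference is [1 - lam] times the unsmoothed one. *)
suff E : hist_sum lin_llr h = hist_sum (fun h => llr (learn h)) h + (1 - lam) *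
    (hist_sum (fun h x y => q x * slopeQ (learn h) x y + v y x * slopeV (learn h) x y) h
    - hist_sum own_gain h) by rewrite E; nra.
elim: h {reg reg0} => [|[x y] h IH] /=; first by ring.
rewrite IH /lin_llr /own_gain /slopeQ /slopeV.
have Q0 := inputQ_gt0 (learn h) x; have V0 := backV_gt0 (learn h) y x.
move: Q0 V0 (erefl (inputQ (learn h) x)) (erefl (backV (learn h) y x)).
set Q := inputQ _ _; set V := backV _ _ _ => Q0 V0.
rewrite {2}/Q {2}/V /inputQ /backV /smooth => EQ EV.
(* Eliminating [lam / N] through both [Q] and [V] leaves a rational identity. *)
have -> : lam / N = Q - (1 - lam) * softmax eta (gainQ (learn h)) x by rewrite EQ; ring.
have E2 : Q - (1 - lam) * softmax eta (gainQ (learn h)) x =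
  V - (1 - lam) * softmax eta (gainV (learn h) y) x by rewrite EQ EV; ring.
have -> : (1 - lam) * v y x + (Q - (1 - lam) * softmax eta (gainQ (learn h)) x) =
  (1 - lam) * v y x + (V - (1 - lam) * softmax eta (gainV (learn h) y) x) by rewrite E2.
by field; lra.
Qed.

(** * Mean and second moment of the linearised score *)

Section OneStep.
Variable (W : X -> Y -> R).
Hypothesis W_chan : is_channel W.

Let W_ge0 x y : 0 <= W x y. Proof. by case: (W_chan x). Qed.
Let W_sum x : \rsum_(y : Y) W x y = 1. Proof. by case: (W_chan x). Qed.

(** When [v] is the posterior of [q] and [W], this is the mutual information in nats. For fixed [q]
    and [v] it is linear in [W]. *)
Definition linear_info : R :=
  \rsum_(x : X) \rsum_(y : Y) (q x * W x y * ln (v y x / q x)).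

(** Concavity of [q * ln (v / q)]: its tangent at the played pair lies above it, which is
    [ln t <= t - 1] at [t = Q * v / (V * q)]. The uniform part loses at most
    [lam * (llr_bound + 1)]. Positivity of [v] keeps [ln] away from its default value at 0. *)
Lemma lin_llr_drift h :
  (forall x y, 0 < q x -> 0 < W x y -> 0 < v y x) ->
  (1 - lam) * linear_info - lam * (llr_bound + 1) <= joint_mean (inputQ (learn h)) W (lin_llr h).
Proof.
move=> v_gt0; set c := lam / N * (llr_bound + 1).
have N1 := cardX_ge1; have l0 := lamN_gt0.
have -> : lam * (llr_bound + 1) = \rsum_(x : X) \rsum_(y : Y) (W x y * c).
  rewrite (eq_bigr (fun=> c)) => [|x _]; last by rewrite rsumMr W_sum; ring.
  by rewrite rsum_cst -/N /c; field; lra.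
rewrite /linear_info /joint_mean -rsumMl.
have -> : forall a b, a - b = a + (- 1) * b by move=> a b; ring.
rewrite -rsumMl -rsumD; apply: rsum_le => x _.
rewrite -!rsumMl -rsumD; apply: rsum_le => y _.
have Q0 := inputQ_gt0 (learn h) x; have V0 := backV_gt0 (learn h) y x.
have w0 := W_ge0 x y; have q0 := pmf_ge0 q_pmf x; have v0 := pmf_ge0 (v_pmf y) x.
have [a1 a2] := llr_bounded (learn h) x y.
have [w_gt0|w_eq0] : 0 < W x y \/ W x y = 0 by lra.
  2: by rewrite w_eq0; lra.
rewrite /lin_llr; set Q := inputQ _ _ in Q0 *; set V := backV _ _ _ in V0 *.
set a := llr _ _ _ in a1 a2 *.
have ratio : q x * ln (v y x / q x) <= q x * (a - 1) + Q * (v y x / V).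
  have qV0 : 0 <= Q * (v y x / V).
    apply: Rmult_le_pos; first lra.
    by apply: Rmult_le_pos => //; left; apply: Rinv_0_lt_compat.
  have [q_gt0|<-] : 0 < q x \/ 0 = q x by lra.
    2: lra.
  have v_pos := v_gt0 _ _ q_gt0 w_gt0.
  have t0 : 0 < Q * v y x / (V * q x) by apply: Rdiv_lt_0_compat; apply: Rmult_lt_0_compat.
  have := ln_le_sub1 t0.
  have -> : Q * v y x / (V * q x) = (v y x / q x) / (V / Q) by field; lra.
  have r1 : 0 < v y x / q x by apply: Rdiv_lt_0_compat.
  have r2 : 0 < V / Q by apply: Rdiv_lt_0_compat.
  rewrite {1}/Rdiv ln_mult ?ln_Rinv //; last exact: Rinv_0_lt_compat.
  rewrite -/(llr (learn h) x y) -/a => hl.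
  have : q x * (ln (v y x / q x) + - a) <= q x * (v y x / q x / (V / Q) - 1).
    by apply: Rmult_le_compat_l.
  have -> : q x * (v y x / q x / (V / Q) - 1) = Q * (v y x / V) - q x by field; lra.
  lra.
have E : Q * (W x y * (smooth q x / Q * (a - 1) + smooth (v y) x / V)) =
  W x y * ((1 - lam) * (q x * (a - 1) + Q * (v y x / V)) +
           lam / N * (a - 1) + lam / N * (Q / V)).
  by rewrite /smooth; field; lra.
rewrite E /c.
have -> : (1 - lam) * (q x * W x y * ln (v y x / q x)) + -1 * (W x y * (lam / N * (llr_bound + 1)))
  = W x y * ((1 - lam) * (q x * ln (v y x / q x)) - lam / N * (llr_bound + 1)) by ring.
apply: Rmult_le_compat_l => //.
have p1 : 0 <= lam / N * (Q / V).
  by apply: Rmult_le_pos; [lra | left; apply: Rdiv_lt_0_compat].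
by nra.
Qed.

(** The ratio [smooth q / Q] has mean 1 under [Q], so its square costs one factor [N / lam]; the
    backward ratio is bounded pointwise and costs two. *)
Lemma lin_llr_second_moment h :
  joint_mean (inputQ (learn h)) W (fun x y => lin_llr h x y ^ 2) <=
  2 * (N / lam) * (llr_bound + 1) ^ 2 + 2 * (N / lam) ^ 2.
Proof.
set B := llr_bound + 1; rewrite /joint_mean.
have sq := smooth_pmf q_pmf.
have <- : \rsum_(x : X) (smooth q x * (2 * (N / lam) * B ^ 2) +
     inputQ (learn h) x * (2 * (N / lam) ^ 2)) =
     2 * (N / lam) * B ^ 2 + 2 * (N / lam) ^ 2.
  by rewrite rsumD !pmf_mean_cst //; apply: inputQ_pmf.
apply: rsum_le => x _; have Q0 := inputQ_gt0 (learn h) x.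
set Q := inputQ _ _ in Q0 *.
have -> : smooth q x * (2 * (N / lam) * B ^ 2) + Q * (2 * (N / lam) ^ 2) =
  Q * (2 * (smooth q x / Q) * (N / lam) * B ^ 2 + 2 * (N / lam) ^ 2).
  by have N1 := cardX_ge1; field; lra.
apply: Rmult_le_compat_l; first lra.
apply: (pmf_mean_le (W_chan x)) => y.
have s1 : 0 <= smooth q x <= 1 by split; [apply: pmf_ge0 | apply: pmf_le1].
have s2 : 0 <= smooth (v y) x <= 1.
  by have vp := smooth_pmf (v_pmf y); split; [apply: pmf_ge0 | apply: pmf_le1].
have r1 := ratio_le_inv (inputQ_ge (learn h) x) s1.
have r2 := ratio_le_inv (backV_ge (learn h) y x) s2.
have V0 := backV_gt0 (learn h) y x.
have r1' : 0 <= smooth q x / Q.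
  by apply: Rmult_le_pos; [lra | left; apply: Rinv_0_lt_compat].
have r2' : 0 <= smooth (v y) x / backV (learn h) y x.
  by apply: Rmult_le_pos; [lra | left; apply: Rinv_0_lt_compat].
have := llr_bounded (learn h) x y.
rewrite /lin_llr -/Q /B; move: r1 r2 r1' r2'; rewrite -/Q.
set s := _ / Q; set t := _ / backV _ _ _; set a := llr _ _ _; set K := N / lam.
move=> sK tK s0 t0 aB.
have a2 : (a - 1) ^ 2 <= (llr_bound + 1) ^ 2 by nra.
have a0 : 0 <= (a - 1) ^ 2 by apply: pow2_ge_0.
have e1 : s ^ 2 * (a - 1) ^ 2 <= s * K * (llr_bound + 1) ^ 2.
  by apply: Rmult_le_compat => //; nra.
have e2 : t ^ 2 <= K ^ 2 by nra.
have e3 := pow2_ge_0 (s * (a - 1) - t).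
nra.
Qed.

End OneStep.
End Comparator.
End Learner.

(** * Markov chains and product laws *)

Section Chain.
Variables (St : Type) (Z : finType) (kern : nat -> St -> Z -> R) (step : St -> Z -> St).

(** Expectation by backward recursion: [m] steps remain, and the clock [k] is kept because the
    channel may change at every use. *)
Fixpoint run_mean (m k : nat) (st : St) (F : St -> R) : R :=
  if m is m'.+1 then \rsum_(z : Z) (kern k st z * run_mean m' k.+1 (step st z) F)
  else F st.

Lemma run_meanD m k st F G :
  run_mean m k st (fun s => F s + G s) = run_mean m k st F + run_mean m k st G.
Proof.
elim: m k st => [|m IH] k st //=.
by rewrite -rsumD; apply: eq_bigr => z _; rewrite IH; ring.
Qed.

Hypothesis kern_pmf : forall k st, is_pmf (kern k st).

Lemma run_mean_cst m k st c : run_mean m k st (fun=> c) = c.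
Proof.
elim: m k st => [|m IH] k st //=.
by rewrite (eq_bigr (fun z => kern k st z * c)) ?pmf_mean_cst // => z _; rewrite IH.
Qed.

Variables (Inv : nat -> St -> Prop) (n : nat).
Hypothesis Inv_step : forall k st z, (k < n)%N -> Inv k st -> Inv k.+1 (step st z).

Lemma run_mean_le m k st F G : (m + k = n)%N -> Inv k st ->
  (forall s, Inv n s -> F s <= G s) -> run_mean m k st F <= run_mean m k st G.
Proof.
move=> + + FG; elim: m k st => [|m IH] k st /= mk Ik; first by apply: FG; rewrite -mk.
have kn : (k < n)%N by rewrite -mk addSn ltnS leq_addl.
apply: rsum_le => z _; apply: Rmult_le_compat_l; first exact: pmf_ge0.
by apply: IH; [rewrite addnS -addSn | apply: Inv_step].
Qed.

Lemma run_mean_drift F c :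
  (forall k st, (k < n)%N -> Inv k st ->
     \rsum_(z : Z) (kern k st z * F (step st z)) <= F st + c) ->
  forall m k st, (m + k = n)%N -> Inv k st -> run_mean m k st F <= F st + INR m * c.
Proof.
move=> drift; elim=> [|m IH] k st mk Ik; first by rewrite /=; lra.
have kn : (k < n)%N by rewrite -mk addSn ltnS leq_addl.
apply: (@Rle_trans _ (\rsum_(z : Z) (kern k st z * (F (step st z) + INR m * c)))).
  apply: rsum_le => z _; apply: Rmult_le_compat_l; first exact: pmf_ge0.
  by apply: IH; [rewrite addnS -addSn | apply: Inv_step].
rewrite (eq_bigr (fun z => kern k st z * F (step st z) + kern k st z * (INR m * c))).
  by rewrite rsumD pmf_mean_cst // S_INR; have := drift k st kn Ik; lra.
by move=> z _; ring.
Qed.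

End Chain.

(** * Tuples as paths of a chain *)

Lemma rsum_tuple_cons (S : finType) m (F : m.+1.-tuple S -> R) :
  \rsum_(t : m.+1.-tuple S) F t = \rsum_(a : S) \rsum_(t : m.-tuple S) F [tuple of a :: t].
Proof.
rewrite pair_bigA /= (reindex (fun p : S * m.-tuple S => [tuple of p.1 :: p.2])) //=.
exists (fun t => (thead t, [tuple of behead t])) => [[a t] _|t _] /=.
  by congr (_, _); apply: val_inj.
by rewrite [in RHS](tuple_eta t).
Qed.

Lemma rsum_tuple0 (S : finType) (F : 0.-tuple S -> R) :
  \rsum_(t : 0.-tuple S) F t = F [tuple].
Proof.
by rewrite (@rsum_only _ _ [tuple]) // => t; rewrite (tuple0 t) eqxx.
Qed.

Lemma rsum_pair (S Y : finType) (F : S * Y -> R) :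
  \rsum_(z : S * Y) F z = \rsum_(a : S) \rsum_(c : Y) F (a, c).
Proof. by rewrite pair_bigA; apply: eq_bigr => -[]. Qed.

(** Splitting off the first pair matches one unfolding of the recursion. This turns sums over common
    randomness and outputs into expectations of a chain. *)
Lemma run_mean_tuples (St : Type) (S Y : finType) (kern : nat -> St -> S * Y -> R) step m k st F :
  \rsum_(s : m.-tuple S) \rsum_(y : m.-tuple Y)
    (\rprod_(i < m) kern (k + i)%N (foldl step st (zip (take i s) (take i y)))
       (tnth s i, tnth y i) * F (foldl step st (zip s y))) =
  run_mean kern step m k st F.
Proof.
elim: m k st => [|m IH] k st.
  by rewrite !rsum_tuple0 big_ord0 Rmult_1_l.
rewrite rsum_tuple_cons [RHS]/= rsum_pair.
apply: eq_bigr => a _.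
rewrite (eq_bigr _ (fun s _ => rsum_tuple_cons _)).
rewrite exchange_big; apply: eq_bigr => c _ /=.
rewrite -IH -rsumMl; apply: eq_bigr => s _.
rewrite -rsumMl; apply: eq_bigr => y _.
rewrite big_ord_recl /= addn0 !tnth0 -Rmult_assoc; congr (_ * _ * _).
by apply: eq_bigr => i _; rewrite !tnthS addnS.
Qed.

Lemma rsum_tuple_prod (S : finType) (p : S -> R) m : is_pmf p ->
  \rsum_(s : m.-tuple S) \rprod_(i < m) p (tnth s i) = 1.
Proof.
move=> pp; elim: m => [|m IH]; first by rewrite rsum_tuple0 big_ord0.
rewrite rsum_tuple_cons -(pmf_sum pp); apply: eq_bigr => a _.
rewrite -[RHS]Rmult_1_r -IH -rsumMl; apply: eq_bigr => s _.
rewrite big_ord_recl /= tnth0; congr (_ * _).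
by apply: eq_bigr => i _; rewrite tnthS.
Qed.

(** * Product laws and independence of coordinates *)

Section ProductLaw.
Variables (K X : finType) (p : K -> X -> R).
Hypothesis p_pmf : forall k, is_pmf (p k).

Definition ffun_law (s : {ffun K -> X}) : R := \big[Rmult/R1]_(k : K) p k (s k).

Lemma ffun_law_prod (phi : K -> X -> R) :
  \rsum_(s : {ffun K -> X}) (ffun_law s * \big[Rmult/R1]_(k : K) phi k (s k)) =
  \big[Rmult/R1]_(k : K) \rsum_(x : X) (p k x * phi k x).
Proof. by rewrite bigA_distr_bigA; apply: eq_bigr => s _; rewrite big_split. Qed.

Lemma ffun_law_eval2 k1 k2 (f g : X -> R) : k1 != k2 ->
  \rsum_(s : {ffun K -> X}) (ffun_law s * (f (s k1) * g (s k2))) =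
  (\rsum_(x : X) (p k1 x * f x)) * \rsum_(x : X) (p k2 x * g x).
Proof.
move=> k12; have k21 : k2 != k1 by rewrite eq_sym.
pose phi k x := if k == k1 then f x else if k == k2 then g x else 1.
transitivity (\big[Rmult/R1]_(k : K) \rsum_(x : X) (p k x * phi k x)).
  rewrite -ffun_law_prod; apply: eq_bigr => s _; congr (_ * _).
  rewrite (bigD1 k1) //= (bigD1 k2) //= /phi eqxx (negPf k21) eqxx big1 ?Rmult_1_r //.
  by move=> k /andP[/negPf -> /negPf ->].
rewrite (bigD1 k1) //= (bigD1 k2) //= [X in _ * (_ * X)]big1 => [|k /andP[/negPf k1' /negPf k2']].
  by rewrite /phi eqxx (negPf k21) eqxx Rmult_1_r.
rewrite /phi k1' k2' -[RHS](pmf_sum (p_pmf k)).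
by apply: eq_bigr => x _; rewrite Rmult_1_r.
Qed.

Lemma ffun_law_eval k1 (f : X -> R) :
  \rsum_(s : {ffun K -> X}) (ffun_law s * f (s k1)) = \rsum_(x : X) (p k1 x * f x).
Proof.
pose phi k x := if k == k1 then f x else 1.
transitivity (\big[Rmult/R1]_(k : K) \rsum_(x : X) (p k x * phi k x)).
  rewrite -ffun_law_prod; apply: eq_bigr => s _; congr (_ * _).
  by rewrite (bigD1 k1) //= /phi eqxx big1 ?Rmult_1_r // => k /negPf ->.
rewrite (bigD1 k1) //= [X in _ * X]big1 => [|k /negPf k1'].
  by rewrite /phi eqxx Rmult_1_r.
rewrite /phi k1' -[RHS](pmf_sum (p_pmf k)).
by apply: eq_bigr => x _; rewrite Rmult_1_r.
Qed.

Lemma ffun_law_pmf : is_pmf ffun_law.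
Proof.
split=> [s|]; first by apply: rprod_ge0 => k _; apply: pmf_ge0.
rewrite /ffun_law -(bigA_distr_bigA (fun k x => p k x)) big1 // => k _.
exact: pmf_sum.
Qed.

End ProductLaw.

(** * The block code *)

Definition Rleb (a b : R) : bool := if Rle_dec a b then true else false.

Lemma RlebP a b : reflect (a <= b) (Rleb a b).
Proof. by rewrite /Rleb; case: Rle_dec => h; constructor. Qed.

Definition indic (b : bool) : R := if b then 1 else 0.

Section Coding.
Variables (X Y : finType) (n K : nat).
Notation hist := (seq (X * Y)).
Notation cand := (K.-tuple bool).
Variables (Qf : hist -> X -> R) (af : hist -> X -> Y -> R) (T : R).
Hypothesis Qf_pmf : forall h, is_pmf (Qf h).

(* The common randomness of one channel use: an independent letter, of law
   [Qf h], for each candidate block of [K] bits and each history [h]. *)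
Definition book : finType := {ffun cand * n.-bseq (X * Y)%type -> X}.

Definition book_law : book -> R :=
  ffun_law (fun key : cand * n.-bseq (X * Y)%type => Qf key.2).

Lemma book_law_pmf : is_pmf book_law.
Proof. by apply: ffun_law_pmf => key; apply: Qf_pmf. Qed.

(** A history longer than [n] would fall back on a default key; this does not occur within [n]
    uses. *)
Definition letter (s : book) (c : cand) (h : hist) : X := s (c, insub_bseq n h).

Lemma insub_bseqK (h : hist) : (size h <= n)%N -> insub_bseq n h = h :> seq _.
Proof. by move=> hn; rewrite /insub_bseq insubdK. Qed.

Lemma letter_mean c h (f : X -> R) : (size h <= n)%N ->
  \rsum_(s : book) (book_law s * f (letter s c h)) = \rsum_(x : X) (Qf h x * f x).
Proof.
move=> hn; rewrite (ffun_law_eval (fun key : cand * n.-bseq (X * Y)%type => Qf_pmf key.2)).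
by rewrite /= insub_bseqK.
Qed.

(** Distinct candidates have distinct keys even when their histories agree, so their letters are
    independent. *)
Lemma letter_mean2 c c' h h' (f g : X -> R) : c != c' ->
  (size h <= n)%N -> (size h' <= n)%N ->
  \rsum_(s : book) (book_law s * (f (letter s c h) * g (letter s c' h'))) =
  (\rsum_(x : X) (Qf h x * f x)) * \rsum_(x : X) (Qf h' x * g x).
Proof.
move=> cc' hn hn'.
rewrite (ffun_law_eval2 (fun key : cand * n.-bseq (X * Y)%type => Qf_pmf key.2)).
  by rewrite /= !insub_bseqK.
by apply/eqP => -[/eqP]; rewrite (negPf cc').
Qed.

(* The decoder state: the blocks decoded so far, and for each candidate for
   the current block the history it would imply and its score. *)
Record dstate := Dstate {
  decoded : seq cand;
  dhist : cand -> hist;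
  score : cand -> R
}.

Definition dinit := Dstate [::] (fun=> [::]) (fun=> 0).

Definition next_hist (d : dstate) (z : book * Y) c : hist :=
  (letter z.1 c (dhist d c), z.2) :: dhist d c.

Definition next_score (d : dstate) (z : book * Y) c : R :=
  score d c + af (dhist d c) (letter z.1 c (dhist d c)) z.2.

Definition winner (d : dstate) (z : book * Y) : option cand :=
  [pick c | Rleb T (next_score d z c)].

(** After a win all candidates for the next block inherit the winner's history, so the learner keeps
    what it has learnt; only the scores restart. *)
Definition dstep (d : dstate) (z : book * Y) : dstate :=
  if winner d z is Some c
  then Dstate (rcons (decoded d) c) (fun=> next_hist d z c) (fun=> 0)
  else Dstate (decoded d) (next_hist d z) (next_score d z).

(** * Encoder and decoder as one Markov chain *)

Variables (W : nat -> X -> Y -> R) (b : seq bool).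
Hypothesis W_chan : forall k, is_channel (W k).

(** If fewer than [K] bits remain, the block defaults to all [false]. *)
Definition block (j : nat) : cand :=
  insubd (nseq_tuple K false) (take K (drop (j * K) b)).

(** Feedback and common randomness let the encoder follow the decoder state [dpart]. [ehist] holds
    the pairs actually sent and received, and [wrong] stays set after the first wrong block. *)
Record cstate := Cstate { dpart : dstate; ehist : hist; wrong : bool }.

Definition cinit := Cstate dinit [::] false.

Definition sent (st : cstate) : cand := block (size (decoded (dpart st))).

Definition input (st : cstate) (s : book) : X := letter s (sent st) (ehist st).

Definition cstep (st : cstate) (z : book * Y) : cstate :=
  Cstate (dstep (dpart st) z) ((input st z.1, z.2) :: ehist st)
    (wrong st || (if winner (dpart st) z is Some c then c != sent st else false)).

Definition ckern (k : nat) (st : cstate) (z : book * Y) : R :=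
  book_law z.1 * W k (input st z.1) z.2.

Lemma ckern_pmf k st : is_pmf (ckern k st).
Proof.
split=> [z|].
  apply: Rmult_le_pos; first exact: (pmf_ge0 book_law_pmf).
  exact: (pmf_ge0 (W_chan k _)).
rewrite rsum_pair -[RHS](pmf_sum book_law_pmf); apply: eq_bigr => s _.
by rewrite /ckern /= rsumMl (pmf_sum (W_chan k _)) Rmult_1_r.
Qed.

Definition sizes_inv (k : nat) (st : cstate) : Prop :=
  size (ehist st) = k /\ forall c, size (dhist (dpart st) c) = k.

Lemma sizes_inv_step k st z : sizes_inv k st -> sizes_inv k.+1 (cstep st z).
Proof.
move=> [ek dk]; split; first by rewrite /= ek.
by move=> c; rewrite /= /dstep; case: winner => [c'|] /=; rewrite dk.
Qed.

(** * Probability of a wrongly decoded block *)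

Section ErrorProbability.
Hypothesis exp_af_mean : forall h y, \rsum_(x : X) (Qf h x * exp (af h x y)) = 1.

Definition wrong_mass (st : cstate) (sc : cand -> R) : R :=
  \big[Rplus/R0]_(c : cand | c != sent st) exp (sc c).

(* A candidate that is not sent wins only if its own exponential score, a
   martingale, exceeds [exp T]; the new phase brings a mass at most [2 ^ K]. *)
Definition error_potential (st : cstate) : R :=
  exp T * indic (wrong st) + wrong_mass st (score (dpart st)).

Lemma INR_expn2 m : INR (expn 2 m) = 2 ^ m.
Proof. by elim: m => [|m IH] //; rewrite expnS mult_INR IH. Qed.

Lemma wrong_mass0 st : wrong_mass st (fun=> 0) <= 2 ^ K.
Proof.
rewrite /wrong_mass rsum_const exp_0 Rmult_1_r -INR_expn2.
apply: le_INR; apply/leP; apply: leq_trans (max_card _) _.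
by rewrite card_tuple card_bool.
Qed.

Lemma wrong_mass_ge0 st sc : 0 <= wrong_mass st sc.
Proof. by apply: rsum_ge0 => c _; left; apply: exp_pos. Qed.

Lemma winnerP d z c : winner d z = Some c -> T <= next_score d z c.
Proof. by rewrite /winner; case: pickP => // c' /RlebP + [<-]. Qed.

Lemma loserP d z : winner d z = None -> forall c, next_score d z c < T.
Proof.
rewrite /winner; case: pickP => // h _ c.
by case: RlebP (h c) => // Tc _; lra.
Qed.

Lemma error_potential_step st z :
  error_potential (cstep st z) <=
  exp T * indic (wrong st) + wrong_mass st (next_score (dpart st) z) + 2 ^ K.
Proof.
rewrite /error_potential /=; have m0 := wrong_mass_ge0 st (next_score (dpart st) z).
have eT := exp_pos T; have K2 : 0 <= 2 ^ K by apply: pow_le; lra.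
case E : (winner (dpart st) z) => [c|]; last first.
  rewrite orbF; rewrite {1}/wrong_mass /sent /= /dstep E /= -/(sent st) -/(wrong_mass st _).
  lra.
have := wrong_mass0 (cstep st z); rewrite /dstep E /=.
set M := wrong_mass (cstep st z) _ => M2.
case: (wrong st) => /=; first by lra.
have [|ct] := boolP (c != sent st) => /=; last by lra.
move=> ct; have := winnerP E => Tc.
have : exp (next_score (dpart st) z c) <= wrong_mass st (next_score (dpart st) z).
  by apply: (@rsum_term_le _ _ (fun c => exp (next_score (dpart st) z c))) => // c' _; left; apply: exp_pos.
have : exp T <= exp (next_score (dpart st) z c).
  by case: Tc => [lt|->]; [left; apply: exp_increasing | lra].
lra.
Qed.

(** The output depends on the book only through the letter of the sent candidate, which is
    independent of the letter of [c]. Averaging the latter gives the factor 1 of [exp_af_mean] for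
    each output. *)
Lemma wrong_mass_mean k st : (k < n)%N -> sizes_inv k st ->
  \rsum_(z : book * Y) (ckern k st z * wrong_mass st (next_score (dpart st) z)) =
  wrong_mass st (score (dpart st)).
Proof.
move=> kn [ek dk].
have -> : \rsum_(z : book * Y) (ckern k st z * wrong_mass st (next_score (dpart st) z)) =
   \big[Rplus/R0]_(c : cand | c != sent st) \rsum_(z : book * Y)
     (ckern k st z * exp (next_score (dpart st) z c)).
  by rewrite exchange_big; apply: eq_bigr => z _; rewrite -rsumMl.
apply: eq_bigr => c ct; rewrite rsum_pair exchange_big /=.
have hn : (size (ehist st) <= n)%N by rewrite ek ltnW.
have hn' : (size (dhist (dpart st) c) <= n)%N by rewrite dk ltnW.
rewrite (eq_bigr (fun y => exp (score (dpart st) c) *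
    \rsum_(x : X) (Qf (ehist st) x * W k x y))); last first.
  move=> y _; rewrite -[RHS]Rmult_1_r -(exp_af_mean (dhist (dpart st) c) y) Rmult_assoc.
  rewrite -(@letter_mean2 (sent st) c _ _ (fun x => W k x y)
              (fun x => exp (af (dhist (dpart st) c) x y))) 1?eq_sym //.
  rewrite -rsumMl; apply: eq_bigr => s _.
  by rewrite /ckern /next_score /input exp_plus /=; ring.
rewrite rsumMl exchange_big /= -[RHS]Rmult_1_r; congr (_ * _).
rewrite -[RHS](pmf_sum (Qf_pmf (ehist st))); apply: eq_bigr => x _.
by rewrite rsumMl (pmf_sum (W_chan k _)) Rmult_1_r.
Qed.

Lemma error_potential_drift k st : (k < n)%N -> sizes_inv k st ->
  \rsum_(z : book * Y) (ckern k st z * error_potential (cstep st z)) <=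
  error_potential st + 2 ^ K.
Proof.
move=> kn inv; have kp := ckern_pmf k st.
apply: (@Rle_trans _ (\rsum_(z : book * Y)
   (ckern k st z * (exp T * indic (wrong st) + 2 ^ K) +
    ckern k st z * wrong_mass st (next_score (dpart st) z)))).
  apply: rsum_le => z _; rewrite -Rmult_plus_distr_l.
  apply: Rmult_le_compat_l; first exact: (pmf_ge0 kp).
  have := error_potential_step st z; lra.
by rewrite rsumD wrong_mass_mean // pmf_mean_cst // /error_potential; lra.
Qed.

End ErrorProbability.

(** * Deviation of a score from its conditional means *)

Section Deviation.
Variables (g : hist -> X -> Y -> R) (var : R).
Hypothesis g_var : forall k h,
  joint_mean (Qf h) (W k) (fun x y => g h x y ^ 2) <= var.

(** The length of the history is the time index and so selects the channel. *)
Definition centered (h : hist) x y : R :=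
  g h x y - joint_mean (Qf h) (W (size h)) (g h).

Lemma input_mean k st (f : X -> Y -> R) : (k < n)%N -> sizes_inv k st ->
  \rsum_(z : book * Y) (ckern k st z * f (input st z.1) z.2) =
  joint_mean (Qf (ehist st)) (W k) f.
Proof.
move=> kn [ek _]; rewrite rsum_pair /joint_mean.
rewrite -(@letter_mean (sent st) _ (fun x => \rsum_(y : Y) (W k x y * f x y))).
  by apply: eq_bigr => s _; rewrite -rsumMl; apply: eq_bigr => y _; rewrite /ckern /input /=; ring.
by rewrite ek ltnW.
Qed.

Lemma joint_meanD k h (f f' : X -> Y -> R) :
  joint_mean (Qf h) (W k) (fun x y => f x y + f' x y) =
  joint_mean (Qf h) (W k) f + joint_mean (Qf h) (W k) f'.
Proof.
rewrite /joint_mean -rsumD; apply: eq_bigr => x _.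
rewrite -Rmult_plus_distr_l -rsumD; congr (_ * _); apply: eq_bigr => y _; ring.
Qed.

Lemma joint_meanZ k h c (f : X -> Y -> R) :
  joint_mean (Qf h) (W k) (fun x y => c * f x y) = c * joint_mean (Qf h) (W k) f.
Proof.
rewrite /joint_mean -rsumMl; apply: eq_bigr => x _.
rewrite -rsumMl -rsumMl -rsumMl; apply: eq_bigr => y _; ring.
Qed.

Lemma joint_mean_cst k h c : joint_mean (Qf h) (W k) (fun _ _ => c) = c.
Proof.
rewrite /joint_mean -[RHS](pmf_mean_cst (Qf_pmf h)); apply: eq_bigr => x _.
by rewrite (pmf_mean_cst (W_chan k x)).
Qed.

(** Martingale differences are orthogonal: the cross term vanishes in the mean, and the new square
    contributes at most the second moment of [g]. *)
Lemma deviation_drift k st : (k < n)%N -> sizes_inv k st ->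
  \rsum_(z : book * Y) (ckern k st z * hist_sum centered (ehist (cstep st z)) ^ 2) <=
  hist_sum centered (ehist st) ^ 2 + var.
Proof.
move=> kn inv; have [ek _] := inv; set D := hist_sum _ _.
rewrite /= -/D (input_mean (fun x y => (D + centered (ehist st) x y) * ((D + centered (ehist st) x y) * 1))) //.
set h := ehist st in ek *; set m := joint_mean (Qf h) (W k) (g h).
have -> : joint_mean (Qf h) (W k) (fun x y =>
    (D + centered h x y) * ((D + centered h x y) * 1)) =
  joint_mean (Qf h) (W k) (fun x y =>
    ((D - m) ^ 2 + (2 * (D - m)) * g h x y) + g h x y ^ 2).
  apply: eq_bigr => x _; congr (_ * _); apply: eq_bigr => y _.
  by rewrite /centered ek -/m; ring.
rewrite !joint_meanD joint_mean_cst joint_meanZ -/m.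
have := g_var k h; nra.
Qed.

End Deviation.

(** * Score accounting while no block is wrong *)

Section NoError.
Variable B : R.
Hypothesis T_gt0 : 0 < T.
Hypothesis af_le : forall h x y, af h x y <= B.

(** At most one block ends per use. Each finished block absorbs at most [T + B] of the total score:
    it stood below [T] before a last increment of at most [B]. *)
Definition good_inv (k : nat) (st : cstate) : Prop :=
  [/\ sizes_inv k st, (size (decoded (dpart st)) <= k)%N &
   ~~ wrong st ->
   [/\ dhist (dpart st) (sent st) = ehist st,
       decoded (dpart st) = map block (iota 0 (size (decoded (dpart st)))),
       hist_sum af (ehist st) <=
         INR (size (decoded (dpart st))) * (T + B) + score (dpart st) (sent st) &
       score (dpart st) (sent st) < T]].

Lemma good_inv0 : good_inv 0 cinit.
Proof. by split=> // _; split=> //=; lra. Qed.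

Lemma good_inv_step k st z : good_inv k st -> good_inv k.+1 (cstep st z).
Proof.
move=> [sz jk ok]; split; first exact: sizes_inv_step.
  by rewrite /= /dstep; case: winner => [c|] /=; rewrite ?size_rcons ?ltnS // ltnW.
rewrite /= negb_or => /andP[/ok[eh ed es et]].
have ea : next_score (dpart st) z (sent st) =
  score (dpart st) (sent st) + af (ehist st) (input st z.1) z.2.
  by rewrite /next_score eh.
have := af_le (ehist st) (input st z.1) z.2.
rewrite /sent /= /dstep; case E : winner => [c|] /=.
  move=> aB; rewrite negbK => /eqP ->; rewrite size_rcons; split.
  - by rewrite /next_hist eh.
  - by rewrite -addn1 iotaD map_cat -ed cats1.
  - rewrite S_INR /=; move: es aB; set a := af _ _ _; set H := hist_sum _ _; set j := INR _; nra.
  - exact: T_gt0.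
move=> aB _; rewrite -/(sent st); split.
- by rewrite /next_hist eh.
- exact: ed.
- by rewrite ea; move: es; set a := af _ _ _; set H := hist_sum _ _; set j := INR _; lra.
- exact: loserP.
Qed.

End NoError.

End Coding.

(** * The rate-adaptive system *)

Lemma ceilR_INR m : ceilR (INR m) = m.
Proof.
rewrite /ceilR INR_IZR_INZ -opp_IZR /Int_part.
have <- : (- Z.of_nat m + 1)%Z = up (IZR (- Z.of_nat m)).
  by apply: tech_up; rewrite plus_IZR; lra.
by rewrite (_ : (- (- Z.of_nat m + 1 - 1) = Z.of_nat m)%Z) ?Nat2Z.id //; lia.
Qed.

Lemma zip_takel (S Y : Type) (s : seq S) (y : seq Y) i :
  (i <= size s)%N -> zip s (take i y) = zip (take i s) (take i y).
Proof. by elim: s y i => [|a s IH] [|c y] [|i] //= si; rewrite IH. Qed.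

Lemma hist_sum_ge (X Y : Type) (f : seq (X * Y) -> X -> Y -> R) (ik : nat -> R) h :
  (forall h x y, ik (size h) <= f h x y) -> \rsum_(k < size h) ik k <= hist_sum f h.
Proof.
move=> fi; elim: h => [|[x y] h IH]; first by rewrite big_ord0 /=; lra.
rewrite [size _]/= big_ord_recr [hist_sum _ _]/=.
by apply: Rplus_le_compat; [exact: IH | exact: fi].
Qed.

Section System.
Variables (X Y : finType) (n K : nat).
Notation hist := (seq (X * Y)).
Variables (Qf : hist -> X -> R) (af : hist -> X -> Y -> R) (T : R).
Hypothesis n_gt0 : (0 < n)%N.
Hypothesis Qf_pmf : forall h, is_pmf (Qf h).

Notation book := (book X Y n K).
Notation cinit := (@cinit X Y K).
Notation cstep := (@cstep X Y n K af T).
Notation dstep := (@dstep X Y n K af T).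
Notation dinit := (@dinit X Y K).

Definition rate_of_blocks (j : nat) : R := INR (j * K) / INR n.

(** [n * K] bits suffice, as at most one block ends per use. [zip s past] stops at the length of
    [past], so the encoder's state involves earlier uses only. *)
Definition coded_system : ra_system X Y n :=
  @RASystem X Y n (n.-tuple book)
    (fun s => \rprod_(i < n) book_law Qf (tnth s i))
    (n * K)
    (fun i b past s => input b (foldl (cstep b) cinit (zip s past)) (tnth s i))
    (fun y s => rate_of_blocks (size (decoded (foldl dstep dinit (zip s y)))))
    (fun y s => flatten (map val (decoded (foldl dstep dinit (zip s y))))).

Lemma coded_system_valid : valid_system coded_system.
Proof.
split=> /= [|y s].
  split=> [s|]; last exact: (rsum_tuple_prod _ (book_law_pmf _ _ Qf_pmf)).
  by apply: rprod_ge0 => i _; apply: (pmf_ge0 (book_law_pmf _ _ Qf_pmf)).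
apply: Rmult_le_pos; first exact: pos_INR.
by left; apply: Rinv_0_lt_compat; apply: lt_0_INR; apply/ltP.
Qed.

(** * The law of the system as the law of the chain *)

Variables (W : 'I_n -> X -> Y -> R) (Wn : nat -> X -> Y -> R).
Hypothesis WnE : forall i : 'I_n, Wn i = W i.
Hypothesis Wn_chan : forall k, is_channel (Wn k).

Notation ckern := (@ckern X Y n K Qf Wn).
Notation mean_of b F := (run_mean (ckern b) (cstep b) n 0 cinit F).

Lemma dpart_run b zs : dpart (foldl (cstep b) cinit zs) = foldl dstep dinit zs.
Proof.
by rewrite -[dinit]/(dpart cinit); elim: zs cinit => //=.
Qed.

Lemma sys_prob_run (E : cr coded_system -> (nbits coded_system).-tuple bool -> n.-tuple Y -> bool) (Ev : seq bool -> cstate X Y K -> bool) :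
  (forall s (b : (n * K).-tuple bool) y, E s b y = Ev b (foldl (cstep b) cinit (zip s y))) ->
  sys_prob coded_system W E =
  \rsum_(b : (n * K).-tuple bool) (/ 2 ^ (n * K) * mean_of b (fun st => indic (Ev b st))).
Proof.
move=> EE; rewrite /sys_prob /= exchange_big; apply: eq_bigr => b _ /=.
rewrite -run_mean_tuples -rsumMl; apply: eq_bigr => s _.
rewrite -rsumMl; apply: eq_bigr => y _; rewrite EE.
case: (Ev b _) => /=; last by rewrite !Rmult_0_r.
rewrite /joint_prob /= /ckern big_split /= !Rmult_1_r.
rewrite (Rmult_comm _ (/ _)) Rmult_assoc; congr (_ * (_ * _)).
apply: eq_bigr => i _; rewrite add0n WnE zip_takel //.
by rewrite size_tuple ltnW.
Qed.

Lemma mean_over_bits m c : \rsum_(b : m.-tuple bool) (/ 2 ^ m * c) = c.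
Proof.
rewrite rsum_cst card_tuple card_bool INR_expn2.
by field; apply: pow_nonzero; lra.
Qed.

Lemma sys_prob_le (E : cr coded_system -> (nbits coded_system).-tuple bool -> n.-tuple Y -> bool)
  (Ev : seq bool -> cstate X Y K -> bool) c :
  (forall s (b : (n * K).-tuple bool) y, E s b y = Ev b (foldl (cstep b) cinit (zip s y))) ->
  (forall b : (n * K).-tuple bool, mean_of b (fun st => indic (Ev b st)) <= c) ->
  sys_prob coded_system W E <= c.
Proof.
move=> EE bound; apply: Rle_trans (Req_le _ _ (sys_prob_run EE)) _.
rewrite -[X in _ <= X](mean_over_bits (n * K)).
apply: rsum_le => b _; apply: Rmult_le_compat_l => //.
by left; apply: Rinv_0_lt_compat; apply: pow_lt; lra.
Qed.

Lemma sys_prob_ge (E : cr coded_system -> (nbits coded_system).-tuple bool -> n.-tuple Y -> bool)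
  (Ev : seq bool -> cstate X Y K -> bool) c :
  (forall s (b : (n * K).-tuple bool) y, E s b y = Ev b (foldl (cstep b) cinit (zip s y))) ->
  (forall b : (n * K).-tuple bool, c <= mean_of b (fun st => indic (Ev b st))) ->
  c <= sys_prob coded_system W E.
Proof.
move=> EE bound; apply: Rle_trans _ (Req_le _ _ (esym (sys_prob_run EE))).
rewrite -[X in X <= _](mean_over_bits (n * K)).
apply: rsum_le => b _; apply: Rmult_le_compat_l => //.
by left; apply: Rinv_0_lt_compat; apply: pow_lt; lra.
Qed.

Lemma flatten_blocks (b : seq bool) j : (j * K <= size b)%N ->
  flatten (map val (map (block K b) (iota 0 j))) = take (j * K) b.
Proof.
elim: j => [|j IH] jb; first by rewrite take0.
rewrite -addn1 iotaD !map_cat flatten_cat IH /=; last first.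
  by apply: leq_trans jb; rewrite leq_mul2r leqnSn orbT.
rewrite cats0 add0n mulnDl mul1n takeD /block insubdK //.
rewrite -topredE /= size_takel // size_drop -[X in (X <= _)%N](addKn (j * K)) leq_sub2r //.
by rewrite addnC -mulSn.
Qed.

(** * Error and rate from abstract properties of the scores *)

Variables (g : hist -> X -> Y -> R) (var B tau reg eps : R) (ik : nat -> R) (r0 : R).
Hypothesis exp_af_mean : forall h y, \rsum_(x : X) (Qf h x * exp (af h x y)) = 1.
Hypothesis T_gt0 : 0 < T.
Hypothesis af_le : forall h x y, af h x y <= B.
Hypothesis g_var : forall k h,
  joint_mean (Qf h) (Wn k) (fun x y => g h x y ^ 2) <= var.
Hypothesis g_mean : forall k h, ik k <= joint_mean (Qf h) (Wn k) (g h).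
Hypothesis g_sum : forall h, size h = n -> hist_sum g h <= hist_sum af h + reg.
Hypothesis tau_gt0 : 0 < tau.
Hypothesis T_large : (INR n + 1) * 2 ^ K <= eps * exp T.
Hypothesis r0_le : forall j : nat,
  \rsum_(k < n) ik k - tau - reg <= INR j * (T + B) + T -> r0 <= rate_of_blocks j.

Definition error_state (b : seq bool) (st : cstate X Y K) : bool :=
  let m := ceilR (INR n * rate_of_blocks (size (decoded (dpart st)))) in
  (n * K < m)%N || (flatten (map val (decoded (dpart st))) != take m b).

Definition rate_state (st : cstate X Y K) : bool :=
  Rleb r0 (rate_of_blocks (size (decoded (dpart st)))).

Lemma ceil_rate j : ceilR (INR n * rate_of_blocks j) = (j * K)%N.
Proof.
rewrite /rate_of_blocks (_ : INR n * _ = INR (j * K)) ?ceilR_INR //.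
by field; apply: not_0_INR; apply/eqP; rewrite -lt0n.
Qed.

Lemma no_error (b : (n * K).-tuple bool) st :
  good_inv af T b B n st -> ~~ wrong st -> error_state b st = false.
Proof.
move=> [_ jn ok] /ok[_ dE _ _]; rewrite /error_state ceil_rate ltnNge leq_mul2r jn orbT /=.
by apply/negbF/eqP; rewrite {1}dE flatten_blocks // size_tuple leq_mul2r jn orbT.
Qed.

(** The summed drifts minus [tau] bound the total of [g] from below, [reg] passes to the played
    score, and [good_inv] converts that score into decoded blocks. *)
Lemma rate_enough b st : good_inv af T b B n st -> ~~ wrong st ->
  - tau < hist_sum (centered Qf Wn g) (ehist st) -> rate_state st.
Proof.
move=> [[en _] jn ok] /ok[_ _ le lt] dev; apply/RlebP/r0_le.
have gs := g_sum en.
have E : hist_sum g (ehist st) = hist_sum (centered Qf Wn g) (ehist st) +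
    hist_sum (fun h _ _ => joint_mean (Qf h) (Wn (size h)) (g h)) (ehist st).
  by elim: (ehist st) => [|[x y] h IH] /=; [lra | rewrite IH /centered; ring].
have := @hist_sum_ge _ _ (fun h _ _ => joint_mean (Qf h) (Wn (size h)) (g h)) ik (ehist st)
  (fun h _ _ => g_mean (size h) h).
rewrite en; lra.
Qed.

(** Markov's inequality for [error_potential / exp T]: it starts from mass at most [2 ^ K] and gains
    at most [2 ^ K] per use, whence the factor [n + 1] in [T_large]. *)
Lemma wrong_prob b : mean_of b (fun st => indic (wrong st)) <= eps.
Proof.
have kp k st : is_pmf (ckern b k st) by apply: ckern_pmf.
have eT := exp_pos T; have T1 : exp T * / exp T = 1 by apply: Rinv_r; lra.
have iT : 0 < / exp T by apply: Rinv_0_lt_compat.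
apply: (@Rle_trans _ (mean_of b (fun st => / exp T * error_potential T b st))).
  apply: (@run_mean_le _ _ _ (cstep b) kp (@sizes_inv X Y K) n); rewrite ?addn0 //.
    by move=> k st z _; apply: sizes_inv_step.
  move=> st _; rewrite /error_potential Rmult_plus_distr_l -Rmult_assoc (Rmult_comm (/ _)) T1.
  by have := wrong_mass_ge0 b st (score (dpart st)); nra.
apply: Rle_trans.
  apply: (@run_mean_drift _ _ _ (cstep b) kp (@sizes_inv X Y K) n _ _ (/ exp T * 2 ^ K)); rewrite ?addn0 //.
    by move=> k st z _; apply: sizes_inv_step.
  move=> k st kn inv.
  have := error_potential_drift T Qf_pmf b Wn_chan exp_af_mean kn inv.
  rewrite -Rmult_plus_distr_l => /(Rmult_le_compat_l _ _ _ (Rlt_le _ _ iT)).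
  by rewrite -rsumMl => h; apply: Rle_trans h; right; apply: eq_bigr => z _; ring.
rewrite /error_potential /= Rmult_0_r Rplus_0_l.
have := wrong_mass0 b cinit; rewrite -/(score dinit).
move=> /(Rmult_le_compat_l _ _ _ (Rlt_le _ _ iT)) h1.
have := Rmult_le_compat_l _ _ _ (Rlt_le _ _ iT) T_large.
have -> : / exp T * (eps * exp T) = eps by field; lra.
by move: h1; lra.
Qed.

(** The moment bound for Chebyshev's inequality: the integrand is at least 1 when the deviation is
    at most [- tau]. *)
Lemma deviation_prob b : mean_of b (fun st =>
  / tau ^ 2 * hist_sum (centered Qf Wn g) (ehist st) ^ 2) <= INR n * (var / tau ^ 2).
Proof.
have kp k st : is_pmf (ckern b k st) by apply: ckern_pmf.
have it : 0 < / tau ^ 2 by apply: Rinv_0_lt_compat; apply: pow_lt.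
apply: Rle_trans.
  apply: (@run_mean_drift _ _ _ (cstep b) kp (@sizes_inv X Y K) n _ _ (/ tau ^ 2 * var)); rewrite ?addn0 //.
    by move=> k st z _; apply: sizes_inv_step.
  move=> k st kn inv.
  have := deviation_drift af T Qf_pmf b Wn_chan g_var kn inv.
  rewrite -Rmult_plus_distr_l => /(Rmult_le_compat_l _ _ _ (Rlt_le _ _ it)).
  by rewrite -rsumMl => h; apply: Rle_trans h; right; apply: eq_bigr => z _; ring.
by rewrite /= Rmult_0_l Rmult_0_r Rplus_0_l /Rdiv (Rmult_comm (/ _)); right.
Qed.

Lemma coded_system_error : error_prob coded_system W <= eps.
Proof.
apply: (sys_prob_le (Ev := error_state)) => [s b y|b].
  by rewrite /error_event /error_state dpart_run.
apply: Rle_trans (wrong_prob b).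
have kp k st : is_pmf (ckern b k st) by apply: ckern_pmf.
apply: (@run_mean_le _ _ _ (cstep b) kp (@good_inv X Y K af T b B) n); rewrite ?addn0 //.
- by move=> k st z _; apply: good_inv_step.
- exact: good_inv0.
move=> st inv; case E : (wrong st) => /=; first by rewrite /indic; case: error_state; lra.
by rewrite (no_error inv) ?E //=; lra.
Qed.

Lemma coded_system_rate :
  1 - (eps + INR n * (var / tau ^ 2)) <= rate_at_least_prob coded_system W r0.
Proof.
apply: (sys_prob_ge (Ev := fun _ st => rate_state st)) => [s b y|b].
  by rewrite /rate_state dpart_run.
have kp k st : is_pmf (ckern b k st) by apply: ckern_pmf.
set F := fun st => indic (rate_state st).
have := wrong_prob b; have := deviation_prob b; set D := fun st => / tau ^ 2 * _.
move=> hD hw.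
(* Union bound in pointwise form: every final state has enough rate, a large deviation or a wrong
   block. *)
suff : mean_of b (fun=> 1) <= mean_of b (fun st => F st + (D st + indic (wrong st))).
  by rewrite run_mean_cst // !run_meanD; lra.
apply: (@run_mean_le _ _ _ (cstep b) kp (@good_inv X Y K af T b B) n); rewrite ?addn0 //.
- by move=> k st z _; apply: good_inv_step.
- exact: good_inv0.
move=> st inv.
have it : 0 < / tau ^ 2 by apply: Rinv_0_lt_compat; apply: pow_lt.
have D0 : 0 <= D st by apply: Rmult_le_pos; [lra | apply: pow2_ge_0].
have F0 : 0 <= F st by rewrite /F /indic; case: rate_state; lra.
case E : (wrong st) => /=; first by rewrite /indic; lra.
have [dev|dev] := Rlt_le_dec (- tau) (hist_sum (centered Qf Wn g) (ehist st)).
  have r : rate_state st by apply: rate_enough inv _ dev; rewrite E.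
  by rewrite /F r /indic; lra.
suff : 1 <= D st by rewrite /indic; lra.
rewrite /D; apply: (Rmult_le_reg_l (tau ^ 2)); first exact: pow_lt.
have -> : tau ^ 2 * (/ tau ^ 2 * hist_sum (centered Qf Wn g) (ehist st) ^ 2) =
   hist_sum (centered Qf Wn g) (ehist st) ^ 2 by field; lra.
by nra.
Qed.

End System.

(** * Capacity and parameters *)

Lemma ln2_gt_half : / 2 < ln 2.
Proof. exact: ln_lt_2. Qed.

Lemma ln2_lt1 : ln 2 < 1.
Proof.
rewrite -[X in _ < X]ln_exp; apply: ln_increasing; first lra.
by have := exp_ineq1 1; lra.
Qed.

Lemma ln_0 : ln 0 = 0.
Proof. by unfold ln; destruct (Rlt_dec 0 0) as [h|h]; [case: (Rlt_irrefl 0) | ]. Qed.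

(** * Capacity through backward channels *)

Section Capacity.
Variables (X Y : finType).
Hypothesis X_gt0 : (0 < #|X|)%N.
Implicit Types (Q : X -> R) (W : X -> Y -> R).

(** The posterior of the input given the output, set to uniform at outputs of probability 0 so that
    it is always a law. *)
Definition backward Q W (y : Y) (x : X) : R :=
  if Rlt_dec 0 (out_marg Q W y) then Q x * W x y / out_marg Q W y else / INR #|X|.

Lemma cardX_gt0 : 0 < INR #|X|.
Proof. by apply: lt_0_INR; apply/ltP. Qed.

Lemma uniform_pmf : is_pmf (fun _ : X => / INR #|X|).
Proof.
have N0 := cardX_gt0; split=> [_|]; first by left; apply: Rinv_0_lt_compat.
by rewrite rsum_cst Rinv_r; lra.
Qed.

Lemma backward_pmf Q W y : is_pmf Q -> is_channel W -> is_pmf (backward Q W y).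
Proof.
move=> Qp Wc; rewrite /backward.
case: Rlt_dec => [o0|_] /=; last exact: uniform_pmf.
split=> [x|].
  apply: Rmult_le_pos; last by left; apply: Rinv_0_lt_compat.
  by apply: Rmult_le_pos; [apply: pmf_ge0 | apply: (pmf_ge0 (Wc x))].
by rewrite /Rdiv rsumMr -/(out_marg Q W y) Rinv_r; lra.
Qed.

Lemma out_marg_gt0 Q W x y : is_pmf Q -> is_channel W ->
  0 < Q x * W x y -> 0 < out_marg Q W y.
Proof.
move=> Qp Wc qw; apply: Rlt_le_trans qw _.
apply: (@rsum_term_le _ xpredT (fun x => Q x * W x y)) => // x' _.
by apply: Rmult_le_pos; [apply: pmf_ge0 | apply: (pmf_ge0 (Wc x'))].
Qed.

Lemma backward_gt0 Q W x y : is_pmf Q -> is_channel W ->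
  0 < Q x -> 0 < W x y -> 0 < backward Q W y x.
Proof.
move=> Qp Wc q0 w0; have qw := Rmult_lt_0_compat _ _ q0 w0.
have o0 := out_marg_gt0 Qp Wc qw; rewrite /backward; case: Rlt_dec => // o0' /=.
exact: Rdiv_lt_0_compat.
Qed.

Lemma mutual_info_backward Q W : is_pmf Q -> is_channel W ->
  mutual_info Q W = linear_info Q (backward Q W) W / ln 2.
Proof.
move=> Qp Wc; rewrite /mutual_info /linear_info /Rdiv -rsumMr; apply: eq_bigr => x _.
rewrite -rsumMr; apply: eq_bigr => y _; have q0 := pmf_ge0 Qp x.
have w0 := pmf_ge0 (Wc x) y; case: Rlt_dec => [qw|qw] /=; last first.
  have -> : Q x * W x y = 0 by nra.
  ring.
have o0 := out_marg_gt0 Qp Wc qw; have q1 : 0 < Q x by nra.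
rewrite /log2 /backward; case: Rlt_dec => // o0' /=.
rewrite (_ : Q x * W x y / out_marg Q W y * / Q x = W x y * / out_marg Q W y).
  by rewrite /Rdiv; ring.
by field; lra.
Qed.

(** [q * ln (v / q) <= v - q <= 1] termwise. This crude bound gives the existence of the supremum
    and the size of the capacity. *)
Lemma linear_info_le Q (v : Y -> X -> R) W : is_pmf Q -> (forall y, is_pmf (v y)) ->
  is_channel W -> linear_info Q v W <= INR #|X|.
Proof.
move=> Qp vp Wc; rewrite -[X in _ <= X]Rmult_1_r -rsum_cst.
apply: rsum_le => x _; rewrite -(pmf_sum (Wc x)); apply: rsum_le => y _.
have q0 := pmf_ge0 Qp x; have w0 := pmf_ge0 (Wc x) y.
have v0 := pmf_ge0 (vp y) x; have v1 := pmf_le1 (vp y) x.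
suff : Q x * ln (v y x / Q x) <= 1 by nra.
have [q1|<-] : 0 < Q x \/ 0 = Q x by lra.
  2: lra.
have [v2|<-] : 0 < v y x \/ 0 = v y x by lra.
  have := ln_le_sub1 (Rdiv_lt_0_compat _ _ v2 q1).
  move/(Rmult_le_compat_l _ _ _ q0).
  have -> : Q x * (v y x / Q x - 1) = v y x - Q x by field; lra.
  lra.
by rewrite /Rdiv Rmult_0_l ln_0 Rmult_0_r; lra.
Qed.

Lemma capacity_lub W : is_channel W -> is_lub (MI_values W) (capacity W).
Proof.
move=> Wc; apply: epsilon_spec.
have [||c cl] := completeness (MI_values W); last by exists c.
  exists (INR #|X| / ln 2) => _ [Q [Qp ->]]; rewrite mutual_info_backward //.
  apply: Rmult_le_compat_r; first by left; apply: Rinv_0_lt_compat; have := ln2_gt_half; lra.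
  by apply: linear_info_le => // y; apply: backward_pmf.
by exists (mutual_info (fun _ : X => / INR #|X|) W), (fun _ : X => / INR #|X|); split=> //; apply: uniform_pmf.
Qed.

Lemma capacity_le W : is_channel W -> capacity W * ln 2 <= INR #|X|.
Proof.
move=> Wc; have [_ least] := capacity_lub Wc; have l2 := ln2_gt_half.
have -> : INR #|X| = INR #|X| / ln 2 * ln 2 by field; lra.
apply: Rmult_le_compat_r; first lra.
apply: least => _ [Q [Qp ->]]; rewrite mutual_info_backward //.
apply: Rmult_le_compat_r; first by left; apply: Rinv_0_lt_compat; lra.
by apply: linear_info_le => // y; apply: backward_pmf.
Qed.

(** A near maximiser serves as comparator, which avoids a compactness argument for the maximum. *)
Lemma capacity_approx W e : is_channel W -> 0 < e ->
  exists2 Q, is_pmf Q & capacity W - e <= mutual_info Q W.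
Proof.
move=> Wc e0; have [_ least] := capacity_lub Wc.
have [//|none] := classic (exists2 Q, is_pmf Q & capacity W - e <= mutual_info Q W).
suff : capacity W <= capacity W - e by lra.
apply: least => _ [Q [Qp ->]].
by have [|lt] := Rle_lt_dec (mutual_info Q W) (capacity W - e) => //; case: none; exists Q => //; lra.
Qed.

Lemma avg_channel_chan n (W : 'I_n -> X -> Y -> R) : (0 < n)%N ->
  (forall i, is_channel (W i)) -> is_channel (avg_channel W).
Proof.
move=> n0 Wc x; have N0 : 0 < INR n by apply: lt_0_INR; apply/ltP.
have I0 := Rinv_0_lt_compat _ N0; split=> [y|].
  by apply: Rmult_le_pos; [lra | apply: rsum_ge0 => i _; apply: (pmf_ge0 (Wc i x))].
rewrite rsumMl exchange_big /= (eq_bigr (fun=> 1)); last by move=> i _; apply: pmf_sum (Wc i x).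
by rewrite rsum_cst card_ord Rmult_1_r Rinv_l; lra.
Qed.

(** The posterior is taken for the averaged channel while the drift bound is applied to each single
    channel; this carries positivity from one to the other. *)
Lemma avg_channel_gt0 n (W : 'I_n -> X -> Y -> R) i x y :
  (forall i, is_channel (W i)) -> 0 < W i x y -> 0 < avg_channel W x y.
Proof.
move=> Wc w0; have n0 : (0 < n)%N by apply: leq_ltn_trans (ltn_ord i).
apply: Rmult_lt_0_compat; first by apply: Rinv_0_lt_compat; apply: lt_0_INR; apply/ltP.
apply: Rlt_le_trans w0 _; apply: (@rsum_term_le _ xpredT (fun i => W i x y)) => // j _.
exact: (pmf_ge0 (Wc j x)).
Qed.

(** By linearity in the channel, one comparator serves all uses; this is how the averaged channel
    enters. *)
Lemma linear_info_avg n (W : 'I_n -> X -> Y -> R) Q v : (0 < n)%N ->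
  \rsum_(i < n) linear_info Q v (W i) = INR n * linear_info Q v (avg_channel W).
Proof.
move=> n0; have N0 : 0 < INR n by apply: lt_0_INR; apply/ltP.
rewrite /linear_info exchange_big -rsumMl; apply: eq_bigr => x _ /=.
rewrite exchange_big -rsumMl; apply: eq_bigr => y _ /=.
rewrite (eq_bigr (fun i => Q x * ln (v y x / Q x) * W i x y)) => [|i _]; last by ring.
rewrite rsumMl /avg_channel; set c := ln _.
have E S : INR n * (Q x * (/ INR n * S) * c) = Q x * c * S by field; lra.
by rewrite E.
Qed.

End Capacity.

(** * Choice of parameters and orders of magnitude *)

Section Tuning.
Variables (n : nat) (N M kappa e : R).
Let L := ln (INR n).
Let r := exp (L / 2).
Let th := sqrt (sqrt (ln (INR n) ^ 2 / INR n)).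
Hypothesis N_ge1 : 1 <= N.
Hypothesis M_ge1 : 1 <= M.
Hypothesis e_gt0 : 0 < e.
Hypothesis n_gt0 : 0 < INR n.
Hypothesis L_ge : 4096 + 6 * N + / e <= L.

Let e_inv : 0 < / e. Proof. exact: Rinv_0_lt_compat. Qed.

Lemma sqr_r : r * r = INR n.
Proof. by rewrite /r -exp_plus (_ : L / 2 + L / 2 = L) ?exp_ln //; field. Qed.

Lemma cube_le_r : L ^ 3 <= r.
Proof.
have h : L / 8 <= exp (L / 8) by have := exp_ineq1_le (L / 8); lra.
have -> : r = exp (L / 8) ^ 4.
  by rewrite /r /= Rmult_1_r -!exp_plus; congr exp; field.
have L8 : 0 <= L / 8 by lra.
apply: (@Rle_trans _ ((L / 8) ^ 4)); last by apply: pow_incr; lra.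
(* [4096 = 8^4] explains the constant in [L_ge]. *)
have -> : (L / 8) ^ 4 = L ^ 3 * (L / 4096) by field.
have : 0 <= L ^ 3 by apply: pow_le; lra.
nra.
Qed.

Lemma r_ge_L : L <= r.
Proof. by have := cube_le_r; have : L <= L ^ 3; [nra | lra]. Qed.

(** The working form of the definition: since [r] is the square root of [n], [th] is the square root
    of [L / r]. *)
Lemma th_sqr : th ^ 2 * r = L.
Proof.
have r0 : 0 < r by apply: exp_pos.
rewrite /th pow2_sqrt; last by apply: sqrt_pos.
rewrite -/L -sqr_r (_ : L ^ 2 / (r * r) = (L / r) ^ 2); last by field; lra.
rewrite sqrt_pow2; first by field; lra.
by apply: Rmult_le_pos; [lra | left; apply: Rinv_0_lt_compat].
Qed.

Lemma th_gt0 : 0 < th.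
Proof.
have [//|E] : 0 < th \/ 0 = th by exact: sqrt_pos.
by have := th_sqr; rewrite -E; lra.
Qed.

Lemma th_le1 : th <= 1.
Proof.
have tr := th_sqr; have rL := r_ge_L; apply: Rnot_lt_le => t1.
have t2 : 1 < th ^ 2 by nra.
nra.
Qed.

Lemma n_th2 : INR n * th ^ 2 = r * L.
Proof. by rewrite -sqr_r -th_sqr; ring. Qed.

Lemma n_th4 : INR n * th ^ 4 = L ^ 2.
Proof. by rewrite -sqr_r -th_sqr; ring. Qed.

(** As [(r * th)^2 = r * L], this reduces after squaring to [L^3 <= r]. *)
Lemma cube_le_nth3 : L ^ 3 <= INR n * th ^ 3.
Proof.
have t0 := th_gt0; have r0 : 0 < r by apply: exp_pos.
have -> : INR n * th ^ 3 = L * (r * th) by rewrite -sqr_r -th_sqr; ring.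
suff : L ^ 2 <= r * th by nra.
apply: Rnot_lt_le => lt.
have : (r * th) * (r * th) < L ^ 2 * L ^ 2 by apply: Rmult_gt_0_lt_compat => //; nra.
have -> : (r * th) * (r * th) = r * L by rewrite -th_sqr; ring.
have := cube_le_r; nra.
Qed.

(** The scores are of order [L], so mixing loses about [n * lam * L = n * th], the target order of
    every loss. *)
Let lam := th / L.
Let B := ln (N / lam).

Lemma lam_gt0 : 0 < lam.
Proof. by have t0 := th_gt0; apply: Rdiv_lt_0_compat; lra. Qed.

Lemma lam_le_half : lam <= / 2.
Proof.
have t0 := th_gt0; have t1 := th_le1.
by apply: (Rmult_le_reg_r L); [lra | rewrite /lam /Rdiv Rmult_assoc Rinv_l; lra].
Qed.

Lemma n_ge_exp : 1 + L <= INR n.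
Proof. by rewrite -[X in _ <= X]exp_ln //; apply: exp_ineq1_le. Qed.

Lemma B_le : B + 1 <= 3 * L.
Proof.
have t0 := th_gt0; have t1 := th_le1; have rL := r_ge_L; have nL := n_ge_exp.
suff : B <= 2 * L by lra.
have -> : 2 * L = ln (INR n * INR n) by rewrite ln_mult // -/L; ring.
have l0 := lam_gt0; apply: ln_le_mono; first by apply: Rdiv_lt_0_compat; lra.
apply: (Rmult_le_reg_r lam) => //; rewrite /Rdiv Rmult_assoc Rinv_l; last lra.
rewrite Rmult_1_r; apply: (@Rle_trans _ (INR n * 1)); first lra.
rewrite Rmult_assoc; apply: Rmult_le_compat_l; first lra.
apply: (Rmult_le_reg_r L); first lra.
rewrite /lam (_ : INR n * (th / L) * L = INR n * th); last by field; lra.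
have : INR n * th ^ 2 <= INR n * th by apply: Rmult_le_compat_l; nra.
rewrite n_th2; nra.
Qed.

Lemma B_ge0 : 0 <= B.
Proof.
have l0 := lam_gt0; have l1 := lam_le_half.
rewrite /B -ln_1; apply: ln_le_mono; first lra.
by apply: (Rmult_le_reg_r lam) => //; rewrite /Rdiv Rmult_assoc Rinv_l; lra.
Qed.

Let eta := / (INR n * th).

Lemma nth_gt0 : 0 < INR n * th.
Proof. by apply: Rmult_lt_0_compat => //; apply: th_gt0. Qed.

Lemma L_le_nth : L <= INR n * th.
Proof.
have t0 := th_gt0; have t1 := th_le1; have rL := r_ge_L.
have : INR n * th ^ 2 <= INR n * th by apply: Rmult_le_compat_l; nra.
rewrite n_th2; nra.
Qed.

Lemma step_size_small : eta * (N / lam * (B + 1)) <= / 2.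
Proof.
have t0 := th_gt0; have B3 := B_le; have B0 := B_ge0; have p0 := nth_gt0.
apply: (Rmult_le_reg_l (INR n * th)) => //.
rewrite /eta -Rmult_assoc Rinv_r ?Rmult_1_l; last lra.
rewrite /lam (_ : N / (th / L) = N * L / th); last by field; lra.
apply: (Rmult_le_reg_r th) => //.
rewrite (_ : N * L / th * (B + 1) * th = N * L * (B + 1)); last by field; lra.
rewrite (_ : INR n * th * / 2 * th = INR n * th ^ 2 / 2); last by field.
rewrite n_th2; have r3 := cube_le_r.
have h1 : N * L * (B + 1) <= N * L * (3 * L) by apply: Rmult_le_compat_l; nra.
have h2 : 6 * N * L <= r.
  have h2 : 6 * N * L <= L * L by apply: Rmult_le_compat_r; lra.
  by apply: Rle_trans r3; have : L * L <= L ^ 3; [nra | lra].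
nra.
Qed.

Let var := 2 * (N / lam) * (B + 1) ^ 2 + 2 * (N / lam) ^ 2.

Lemma B_sqr_le : (B + 1) ^ 2 <= 9 * L ^ 2.
Proof. by have := B_le; have := B_ge0; nra. Qed.

(** The leading term [(N / lam)^2 = N^2 * L^2 / th^2] equals [N^2 * n * th^2] because
    [n * th^4 = L^2]. This balance fixes the exponent 1/4. *)
Lemma var_le : var <= 20 * N ^ 2 * (INR n * th ^ 2).
Proof.
have t0 := th_gt0; have c3 := cube_le_nth3; have b2 := B_sqr_le.
rewrite /var /lam (_ : N / (th / L) = N * L / th); last by field; lra.
have K0 : 0 < N * L / th by apply: Rdiv_lt_0_compat; nra.
apply: (@Rle_trans _ (2 * (N * L / th) * (9 * L ^ 2) + 2 * (N * L / th) ^ 2)).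
  by apply: Rplus_le_compat_r; apply: Rmult_le_compat_l; lra.
apply: (Rmult_le_reg_r (th ^ 2)); first exact: pow_lt.
rewrite (_ : _ * th ^ 2 = 18 * N * (L ^ 3 * th) + 2 * N ^ 2 * L ^ 2); last by field; lra.
rewrite (_ : 20 * N ^ 2 * (INR n * th ^ 2) * th ^ 2 =
   18 * N ^ 2 * (INR n * th ^ 4) + 2 * N ^ 2 * (INR n * th ^ 4)); last by ring.
rewrite {2}n_th4; apply: Rplus_le_compat_r.
have -> : INR n * th ^ 4 = INR n * th ^ 3 * th by ring.
have h : L ^ 3 * th <= INR n * th ^ 3 * th by apply: Rmult_le_compat_r; lra.
have h0 : 0 <= L ^ 3 * th by apply: Rmult_le_pos; [apply: pow_le; lra | lra].
by apply: Rmult_le_compat; nra.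
Qed.

Let reg := M * ln N / eta + INR n * (eta * (4 * (N / lam) * ((B + 1) ^ 2 + 1))).

(** With [eta = / (n * th)] the first term is at once of order [n * th]; the second is of order
    [L^3 / th^2], covered by [cube_le_nth3]. *)
Lemma reg_le : reg <= (M * N + 40 * N) * (INR n * th).
Proof.
have t0 := th_gt0; have c3 := cube_le_nth3; have b2 := B_sqr_le; have p0 := nth_gt0.
have lN : ln N <= N by have := @ln_le_sub1 N; lra.
rewrite /reg Rmult_plus_distr_r; apply: Rplus_le_compat.
  rewrite /eta /Rdiv Rinv_inv; apply: Rmult_le_compat_r; first lra.
  by apply: Rmult_le_compat_l; lra.
rewrite /lam (_ : N / (th / L) = N * L / th); last by field; lra.
have K0 : 0 < N * L / th by apply: Rdiv_lt_0_compat; nra.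
apply: (@Rle_trans _ (INR n * (eta * (4 * (N * L / th) * (10 * L ^ 2))))).
  apply: Rmult_le_compat_l; first lra.
  apply: Rmult_le_compat_l; first by left; apply: Rinv_0_lt_compat.
  by apply: Rmult_le_compat_l; nra.
apply: (Rmult_le_reg_r (th ^ 2)); first exact: pow_lt.
rewrite /eta (_ : _ * th ^ 2 = 40 * N * L ^ 3); last by field; lra.
rewrite (_ : _ * th ^ 2 = 40 * N * (INR n * th ^ 3)); last by ring.
by apply: Rmult_le_compat_l; nra.
Qed.

Variables (K : nat) (C I : R).
Hypothesis K_ge : INR n * th <= INR K.
Hypothesis K_le : INR K <= INR n * th + 1.
Hypothesis kappa_ge0 : 0 <= kappa.
Hypothesis C_le : C * ln 2 <= N.
Hypothesis I_ge : (C - th) * ln 2 <= I.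
Hypothesis I_le : I <= N.

Let T := INR K * ln 2 + ln ((INR n + 1) / e).

Lemma overhead_le : ln ((INR n + 1) / e) <= 3 * L.
Proof.
have nL := n_ge_exp.
have -> : 3 * L = ln (INR n * INR n * INR n).
  by rewrite !ln_mult -/L; try ring; nra.
apply: ln_le_mono; first by apply: Rdiv_lt_0_compat; lra.
rewrite /Rdiv; apply: Rmult_le_compat; nra.
Qed.

Lemma overhead_gt0 : e <= 1 -> 0 < T.
Proof.
move=> e1; have := ln2_gt_half; have K0 := pos_INR K; have nL := n_ge_exp => l2.
suff : 0 < ln ((INR n + 1) / e) by rewrite /T; nra.
rewrite -ln_1; apply: ln_increasing; first lra.
apply: (Rmult_lt_reg_r e) => //; rewrite /Rdiv Rmult_assoc Rinv_l; lra.
Qed.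

(** In units of [n * th]: [M * N + 40 * N] for regret, [N + 3] for mixing, [12 * N] for block
    overheads, 5 for the unfinished block, [kappa] for deviation, 1 for the near maximiser, and some
    slack. The factor 2 comes from [ln 2 > / 2]. *)
Definition rate_constant : R := 2 * (M * N + 54 * N + kappa + 10).

(** By contradiction: too small a rate bounds the number [j] of blocks, hence the total overhead,
    and then the score could not have been reached. *)
Lemma rate_from_score (j : nat) :
  INR n * ((1 - lam) * I - lam * (B + 1)) - kappa * (INR n * th) - reg <=
    INR j * (T + B) + T ->
  C - rate_constant * th <= INR (j * K) / INR n.
Proof.
move=> score_ge; have t0 := th_gt0; have t1 := th_le1; have p0 := nth_gt0.
have rg := reg_le; have B3 := B_le; have B0 := B_ge0; have ov := overhead_le.
have Lp := L_le_nth; have l2 := ln2_gt_half; have l2' := ln2_lt1.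
have j0 := pos_INR j; have l0 := lam_gt0; have l1 := lam_le_half.
have Kg := K_ge; have Kl := K_le.
set p := INR n * th in p0 Kg Kl rg Lp score_ge *.
apply: Rnot_lt_le => small.
have jK : INR (j * K) < INR n * (C - rate_constant * th).
  apply: (Rmult_lt_reg_r (/ INR n)); first exact: Rinv_0_lt_compat.
  by rewrite -[_ * / _]/(INR (j * K) / INR n) (_ : INR n * _ * _ = C - rate_constant * th) //; field; lra.
rewrite mult_INR in jK.
have rc : 0 <= rate_constant.
  have : 0 <= M * N by apply: Rmult_le_pos; lra.
  by rewrite /rate_constant; lra.
have jth : INR j * th <= 2 * N.
  have : INR j * p <= INR j * INR K by apply: Rmult_le_compat_l.
  have : INR n * (C - rate_constant * th) <= INR n * (2 * N).
    apply: Rmult_le_compat_l; first lra.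
    have rt : 0 <= rate_constant * th by apply: Rmult_le_pos; lra.
    apply: Rnot_lt_le => lt.
    have : 2 * N * / 2 < C * ln 2 by apply: Rmult_gt_0_lt_compat; lra.
    by have := C_le; lra.
  move=> h1 h2; apply: (Rmult_le_reg_l (INR n)) => //.
  by move: h2; rewrite /p; lra.
(* About [2 * N / th] blocks, each with overhead of order [L], still cost only order [n * th]. *)
have jL : INR j * L <= 2 * N * p.
  have : L <= p * th.
    have := n_th2; have := r_ge_L; rewrite /p (_ : _ * th * th = INR n * th ^ 2); last by ring.
    move=> h ->; rewrite -[X in X <= _]Rmult_1_l; apply: Rmult_le_compat_r; lra.
  move=> /(Rmult_le_compat_l _ _ _ j0) h; apply: Rle_trans h _.
  by rewrite (_ : INR j * (p * th) = INR j * th * p); [apply: Rmult_le_compat_r; lra | ring].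
have loss : INR n * (lam * (I + (B + 1))) <= (N + 3) * p.
  have -> : (N + 3) * p = INR n * (lam * ((N + 3) * L)) by rewrite /p /lam; field; lra.
  apply: Rmult_le_compat_l; first lra.
  apply: Rmult_le_compat_l; first lra.
  have NL : N * 1 <= N * L by apply: Rmult_le_compat_l; lra.
  lra.
have TB : INR j * (T + B) <= INR j * INR K * ln 2 + 6 * (2 * N * p).
  apply: (@Rle_trans _ (INR j * (INR K * ln 2 + 6 * L))); last lra.
  by apply: Rmult_le_compat_l => //; rewrite /T; lra.
have Tp : T <= 5 * p.
  have : INR K * ln 2 <= INR K * 1 by apply: Rmult_le_compat_l; [apply: pos_INR | lra].
  by rewrite /T; lra.
have IC : INR n * ((C - th) * ln 2) <= INR n * I by apply: Rmult_le_compat_l; lra.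
have jK2 : INR j * INR K * ln 2 < INR n * (C - rate_constant * th) * ln 2.
  by apply: Rmult_lt_compat_r; lra.
have E1 : INR n * (C - rate_constant * th) * ln 2 =
  INR n * ((C - th) * ln 2) + p * ln 2 - rate_constant * (p * ln 2) by rewrite /p; ring.
have E2 : INR n * ((1 - lam) * I - lam * (B + 1)) =
  INR n * I - INR n * (lam * (I + (B + 1))) by ring.
have P2 : p * / 2 <= p * ln 2 by apply: Rmult_le_compat_l; lra.
have P1 : p * ln 2 <= p * 1 by apply: Rmult_le_compat_l; lra.
have rc2 : rate_constant * (p * / 2) <= rate_constant * (p * ln 2) by apply: Rmult_le_compat_l.
have E3 : rate_constant * (p * / 2) = (M * N + 54 * N + kappa + 10) * p.
  by rewrite /rate_constant; field.
nra.
Qed.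

End Tuning.

(** * Assembling the code, its parameters and the comparator *)

Lemma nat_above p : 0 <= p -> exists K : nat, p <= INR K <= p + 1.
Proof.
move=> p0; have [u1 u2] := archimed p; exists (Z.to_nat (up p)).
have up0 : (0 <= up p)%Z by apply: le_IZR; lra.
by rewrite INR_IZR_INZ Z2Nat.id //; lra.
Qed.

Lemma exp_INRl K a : exp (INR K * a) = exp a ^ K.
Proof.
elim: K => [|K IH]; first by rewrite Rmult_0_l exp_0.
by rewrite S_INR (_ : (INR K + 1) * a = a + INR K * a) ?exp_plus ?IH //; ring.
Qed.

Theorem theorem3 (X Y : finType) (HX : (0 < #|X|)%N) (eps delta : R) :
  0 < eps -> 0 < delta ->
  exists (N : nat) (c : R),
    forall n : nat, (N <= n)%N ->
    exists sys : ra_system X Y n,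
      valid_system sys /\
      forall W : 'I_n -> X -> Y -> R,
        (forall i, is_channel (W i)) ->
        error_prob sys W <= eps /\
        rate_at_least_prob sys W (capacity (avg_channel W) - delta_C c n)
          >= 1 - delta.
Proof.
move=> eps_gt0 delta_gt0.
(* [e] is the bound on wrong blocks: at most [eps] for the error, at most [delta / 2] for the rate,
   at most 1 so that [T] is positive. *)
pose e := Rmin (Rmin eps (delta / 2)) 1.
have e_gt0 : 0 < e by do 2?[apply: Rmin_glb_lt]; lra.
have [e1 e2 e3] : [/\ e <= 1, e <= eps & e <= delta / 2].
  have l1 := Rmin_l (Rmin eps (delta / 2)) 1; have l2 := Rmin_l eps (delta / 2).
  have r1 := Rmin_r (Rmin eps (delta / 2)) 1; have r2 := Rmin_r eps (delta / 2).
  by rewrite /e; split; lra.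
have N1 := cardX_ge1 HX; have M1 : 1 <= INR #|Y|.+1 by apply: (le_INR 1); apply/leP.
set N := INR #|X| in N1; set M := INR #|Y|.+1 in M1.
(* Chosen so that [delta / 2 * kappa^2 >= 20 * N^2], as the Chebyshev bound [cheb] requires. *)
pose kappa := 1 + 40 * N ^ 2 / delta.
have kappa1 : 1 <= kappa.
  suff : 0 <= 40 * N ^ 2 / delta by rewrite /kappa; lra.
  by apply: Rmult_le_pos; [nra | left; apply: Rinv_0_lt_compat].
have [n0 [n0_ge _]] := nat_above (Rlt_le _ _ (exp_pos (4096 + 6 * N + / e))).
exists n0.+1, (rate_constant N M kappa) => -[//|n'] n0n; set n := n'.+1.
have n_ge : exp (4096 + 6 * N + / e) <= INR n.
  by apply: Rle_trans n0_ge _; apply: le_INR; apply/leP; apply: ltnW.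
have n_gt0 : 0 < INR n by apply: Rlt_le_trans n_ge; apply: exp_pos.
have L_ge : 4096 + 6 * N + / e <= ln (INR n).
  by rewrite -[X in X <= _]ln_exp; apply: ln_le_mono => //; apply: exp_pos.
pose th := sqrt (sqrt (ln (INR n) ^ 2 / INR n)).
pose lam := th / ln (INR n); pose eta := / (INR n * th).
have t0 : 0 < th := th_gt0 N1 e_gt0 n_gt0 L_ge.
have p0 : 0 < INR n * th := nth_gt0 N1 e_gt0 n_gt0 L_ge.
have l0 : 0 < lam := lam_gt0 N1 e_gt0 n_gt0 L_ge.
have l1 : lam <= / 2 := lam_le_half N1 e_gt0 n_gt0 L_ge.
have eta0 : 0 < eta by apply: Rinv_0_lt_compat.
have small : eta * (N / lam * (llr_bound X lam + 1)) <= / 2 :=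
  step_size_small N1 e_gt0 n_gt0 L_ge.
have [K [K_ge K_le]] := nat_above (Rlt_le _ _ p0).
(* This threshold makes [e * exp T] equal to [(n + 1) * 2 ^ K]. *)
pose T := INR K * ln 2 + ln ((INR n + 1) / e).
have T_gt0 : 0 < T := overhead_gt0 e_gt0 n_gt0 K e1.
have expT : (INR n + 1) * 2 ^ K <= e * exp T.
  have ratio_gt0 : 0 < (INR n + 1) / e by apply: Rdiv_lt_0_compat; lra.
  by rewrite /T exp_plus exp_INRl !exp_ln //; [right; field; lra | lra].
pose Qf (h : seq (X * Y)) := inputQ lam eta (learn lam eta h).
pose af (h : seq (X * Y)) := llr lam eta (learn lam eta h).
have Qf_pmf h : is_pmf (Qf h) by apply: inputQ_pmf.
have af_mean h y : \rsum_(x : X) (Qf h x * exp (af h x y)) = 1 by apply: exp_llr_mean.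
have af_le h x y : af h x y <= llr_bound X lam.
  by have [] := llr_bounded eta HX l0 l1 (learn lam eta h) x y.
(* The system is fixed before the channels; the comparator below enters only the analysis. *)
exists (coded_system n K Qf af T); split; first exact: coded_system_valid.
(* The chain needs a channel at every time; [inord] supplies an arbitrary one beyond [n]. *)
move=> W W_chan; pose Wn (k : nat) := W (inord k).
have WnE (i : 'I_n) : Wn i = W i by rewrite /Wn inord_val.
have Wn_chan k : is_channel (Wn k) by apply: W_chan.
split.
  by apply: Rle_trans e2; apply: (coded_system_error _ Qf_pmf WnE Wn_chan af_mean T_gt0 af_le expT).
set Wa := avg_channel W.
have Wa_chan : is_channel Wa by apply: avg_channel_chan.
(* A slack of [th] is of the same order as the permitted rate loss. *)
have [q q_pmf q_ge] := capacity_approx HX Wa_chan t0.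
pose v := backward q Wa.
have v_pmf y : is_pmf (v y) by apply: backward_pmf.
have v_gt0 k x y : 0 < q x -> 0 < Wn k x y -> 0 < v y x.
  by move=> qx wx; apply: backward_gt0 => //; apply: avg_channel_gt0 wx.
pose I := linear_info q v Wa.
pose ik k := (1 - lam) * linear_info q v (Wn k) - lam * (llr_bound X lam + 1).
have ik_sum : \rsum_(k < n) ik k = INR n * ((1 - lam) * I - lam * (llr_bound X lam + 1)).
  rewrite /ik (eq_bigr (fun k : 'I_n => (1 - lam) * linear_info q v (W k) +
     - (lam * (llr_bound X lam + 1)))) => [|k _]; last by rewrite WnE.
  by rewrite rsumD rsumMl linear_info_avg // rsum_cst card_ord /I -/Wa; ring.
have l2 := ln2_gt_half.
have I_ge : (capacity Wa - th) * ln 2 <= I.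
  rewrite /I (_ : linear_info q v Wa = mutual_info q Wa * ln 2).
    by apply: Rmult_le_compat_r; lra.
  by rewrite mutual_info_backward // -/v; field; lra.
have C_le : capacity Wa * ln 2 <= N by apply: capacity_le.
have I_le : I <= N by apply: linear_info_le.
pose var := 2 * (N / lam) * (llr_bound X lam + 1) ^ 2 + 2 * (N / lam) ^ 2.
have var_small : var <= 20 * N ^ 2 * (INR n * th ^ 2) := var_le N1 e_gt0 n_gt0 L_ge.
have tau_gt0 : 0 < kappa * (INR n * th) by apply: Rmult_lt_0_compat; lra.
have cheb : INR n * (var / (kappa * (INR n * th)) ^ 2) <= delta / 2.
  apply: (Rmult_le_reg_r ((kappa * (INR n * th)) ^ 2)); first exact: pow_lt.
  rewrite (_ : INR n * _ * _ = INR n * var); last by field; split; lra.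
  apply: (@Rle_trans _ (INR n * (20 * N ^ 2 * (INR n * th ^ 2)))).
    by apply: Rmult_le_compat_l; lra.
  rewrite (_ : INR n * _ = 20 * N ^ 2 * (INR n * th) ^ 2); last by ring.
  rewrite (_ : delta / 2 * _ = delta / 2 * kappa ^ 2 * (INR n * th) ^ 2); last by field.
  apply: Rmult_le_compat_r; first exact: pow2_ge_0.
  apply: (@Rle_trans _ (delta / 2 * kappa)).
    by rewrite /kappa (_ : delta / 2 * _ = delta / 2 + 20 * N ^ 2); [lra | field; lra].
  by apply: Rmult_le_compat_l; [lra | nra].
apply: Rle_ge; apply: (@Rle_trans _ (1 - (e + INR n * (var / (kappa * (INR n * th)) ^ 2)))).
  by lra.
apply: (@coded_system_rate X Y n K Qf af T Qf_pmf W Wn WnE Wn_chan (lin_llr lam eta q v)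
  var (llr_bound X lam) (kappa * (INR n * th)) (regret X Y lam eta n) e ik) => //.
- by move=> k h; apply: lin_llr_second_moment.
- by move=> k h; apply: lin_llr_drift => // x y; apply: v_gt0.
- by move=> h hn; rewrite -hn; apply: lin_llr_sum_le.
move=> j; rewrite ik_sum => score_ge.
have kappa0 : 0 <= kappa by lra.
exact: (rate_from_score N1 M1 e_gt0 n_gt0 L_ge K_ge K_le kappa0 C_le I_ge I_le score_ge).
Qed.
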